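(* Let $d\in\{4\cos^2(\pi/n)-1 : n=5,6,7,\dots\}\cup[3,\infty)$, let $\mathcal C$ be the trivalent category with parameter $d$ and trivalent vertex $Y$, and consider the unitary representation $\pi_Y$ of Thompson's group $T$ on the direct limit Hilbert space $\mathfrak H^1_Y$, extending that of $F$. Then $T$ acts irreducibly on the closed linear span of $\{\pi_Y(g)\Psi : g\in T\}$.
   Context: **The trivalent category.** For $d$ as in the claim, $\mathcal C$ is the following tensor category, with objects $1=X^{\otimes 0}$ and $X^{\otimes n}$ ($n\ge 1$). For $k\ge 0$, $\mathcal C_k$ is the complex vector space of linear combinations of planar diagrams (tangles) in a disc with $k$ boundary points numbered $1,\dots,k$ in cyclic order, consisting of strings, closed loops and an arbitrary number of trivalent vertices, up to planar isotopy, modulo the local skein relations: (1) a closed loop is the scalar $d$; (2) a diagram with a face bounded by a single edge attached to a vertex (a ''lollipop'') is $0$; (3) a bigon (two trivalent vertices joined by two parallel edges) equals a single string; (4) a triangle equals $\frac{d-2}{d-1}$ times a trivalent vertex; (5) for diagrams with two bottom and two top boundary points, $I-H=\frac1{d-1}\left(V-C\right)$, where $I$ has its two top points meeting at a vertex joined by a vertical edge to a vertex where the two bottom points meet, $H$ is two vertical strings joined by a horizontal edge, $V$ is two vertical strings, $C$ is a cup joining the top points together with a cap joining the bottom points; and finally modulo the kernel of the positive semidefinite Hermitian form $\langle x,y\rangle$ (linear in $x$) obtained by gluing $x$ to the mirror image of $y$ along the boundary and evaluating the closed diagram in $\mathcal C_0=\mathbb C$. One has $\dim\mathcal C_0=1$,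 $\dim\mathcal C_1=0$, $\dim\mathcal C_2=1$, $\dim\mathcal C_3=1$. $\mathrm{Mor}_{\mathcal C}(X^{\otimes a},X^{\otimes b})$ is $\mathcal C_{a+b}$ drawn in a rectangle with $a$ bottom and $b$ top points; composition is vertical stacking, $\otimes$ is horizontal juxtaposition, and $*$ is reflection in a horizontal line (conjugate linearly). $Y\in\mathrm{Mor}_{\mathcal C}(X,X\otimes X)$ is the single trivalent vertex; $Y^*Y=\mathrm{id}_X$. The rotation $\rho:\mathcal C_n\to\mathcal C_n$ is the unitary of order dividing $n$ obtained by rotating a disc diagram so that the string ending at boundary point $i$ ends at boundary point $i+1$ (mod $n$). **Trees, forests, $F$ and $T$.** $\mathfrak T$ is the set of finite planar rooted binary trees (including the tree with one leaf). A forest $f:m\to n$ is an $m$-tuple of such trees with $n$ leaves in total; forests compose by attaching roots to leaves, so if $s\in\mathfrak T$ has $m$ leaves then $fs\in\mathfrak T$ has $n$ leaves. Write $s\le t$ if $t=fs$ for some forest $f$; this makes $\mathfrak T$ a directed set. Elements of Thompson's group $T$ are represented by triples $(s,k,t)$ with $s,t$ trees with the same number $n$ of leaves and $k\in\mathbb Z/n$; the triple represents the piecewise linear homeomorphism of the circle $[0,1]/\{0\sim1\}$ sending affinely the $i$-th standard dyadic interval defined by the leaves of $t$ onto the $(i+k)$-th (mod $n$) one of $s$. Thompson's group $F$ is the subgroup of elements $\frac st:=(s,0,t)$. **Direct limit and representation.** For a forest $f:m\to n$ let $\Phi(f)\in\mathrm{Mor}_{\mathcal C}(X^{\otimes m},X^{\otimes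 n})$ be $f$ read as a diagram with each branching vertex replaced by $Y$; it satisfies $\Phi(f)^*\Phi(f)=\mathrm{id}$. To a tree $t$ with $n$ leaves associate the Hilbert space $\mathrm{Mor}_{\mathcal C}(1,X^{\otimes n})=\mathcal C_n$ (zero for $n=1$), with inner product $\langle x,y\rangle=y^*x\in\mathcal C_0=\mathbb C$, and for $t=fs$ the isometric connecting map $x\mapsto\Phi(f)\circ x$. $\mathfrak H^1_Y$ is the Hilbert space completion of the direct limit; $\frac tx$ denotes the class of $(t,x)$. $T$ acts unitarily on $\mathfrak H^1_Y$: if $g$ is represented by $(s,k,t)$ then $\pi_Y(g)\left(\frac tx\right)=\frac s{\rho^k(x)}$. The vacuum vector $\Psi$ is the unit vector $\frac{t}{x}$ with $t$ the two-leaf tree and $x=d^{-1/2}$ times the string joining the two boundary points. *)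

(* Defs.v *)
From HB Require Import structures.
From mathcomp Require Import all_boot all_order all_algebra.
From mathcomp Require Import sesquilinear generic_quotient ring_quotient.
From mathcomp Require Import all_classical all_reals all_analysis.
From mathcomp Require Import complex freeg zify.

Set Implicit Arguments.
Unset Strict Implicit.
Unset Printing Implicit Defensive.

Import Order.TTheory GRing.Theory Num.Theory.
Import numFieldNormedType.Exports.

Local Open Scope classical_set_scope.
Local Open Scope ring_scope.

(** * Planar trivalent diagrams

   A diagram drawn in a rectangle is put in generic position with respect to
   the height and read from bottom to top as a word of slices.  The slice
   [Slice i g] is the elementary piece [g] with [i] vertical strings on its
   left and as many vertical strings on its right as fit.  Planar isotopy
   becomes the first five constructors of [relator] below. *)

Inductive piece := Cup | Cap | Split | Merge.

Definition ins (g : piece) : nat :=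
  match g with Cup => 0 | Cap => 2 | Split => 1 | Merge => 2 end%N.

Definition outs (g : piece) : nat :=
  match g with Cup => 2 | Cap => 0 | Split => 2 | Merge => 1 end%N.

Definition flip (g : piece) : piece :=
  match g with Cup => Cap | Cap => Cup | Split => Merge | Merge => Split end.

Record slice := Slice { offset : nat; body : piece }.

HB.instance Definition _ := gen_eqMixin slice.
HB.instance Definition _ := gen_choiceMixin slice.

Definition word := seq slice.

Definition slice_cod (n : nat) (s : slice) : option nat :=
  if (offset s + ins (body s) <= n)%N
  then Some (n - ins (body s) + outs (body s))%N else None.

(* The number of top points of [w] when it has [n] bottom points; [None] when
   [w] cannot be drawn on [n] strings. *)
Fixpoint cod (n : nat) (w : word) : option nat :=
  if w is s :: w' then obind (fun m => cod m w') (slice_cod n s) else Some n.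

Definition shift (i : nat) (w : word) : word :=
  [seq Slice (i + offset s) (body s) | s <- w].

(* Reflection in a horizontal line. *)
Definition mirror (w : word) : word :=
  rev [seq Slice (offset s) (flip (body s)) | s <- w].

Lemma cod_cat n u v : cod n (u ++ v) = obind (fun m => cod m v) (cod n u).
Proof. by elim: u n => [|s u IHu] n //=; case: (slice_cod n s) => /=. Qed.

Lemma cod_shift i j n u m :
  cod n u = Some m -> cod (i + n + j) (shift i u) = Some (i + m + j)%N.
Proof.
elim: u n => [|[l g] u IHu] n /=; first by move=> [->].
rewrite /slice_cod /=; case: leqP => //= le_n /IHu.
have -> : (i + l + ins g <= i + n + j)%N by lia.
rewrite /=; move=> <-; congr cod; lia.
Qed.

Lemma cod_mirror n w m : cod n w = Some m -> cod m (mirror w) = Some n.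
Proof.
elim: w n => [|[l g] w IHw] n /=; first by move=> [->].
rewrite /slice_cod /=; case: leqP => //= le_n /IHw.
rewrite /mirror map_cons rev_cons -cats1 cod_cat => -> /=.
rewrite /slice_cod /=.
have -> : ins (flip g) = outs g by case: g {le_n}.
have -> : outs (flip g) = ins g by case: g {le_n}.
have -> : (l + outs g <= n - ins g + outs g)%N by lia.
by congr Some; lia.
Qed.

(* Diagrams with [m] bottom and [n] top points. *)
Definition diagram (m n : nat) := {w : word | cod m w == Some n}.

HB.instance Definition _ m n := Choice.on (diagram m n).

Definition mk_diagram m n (w : word) (w_mn : cod m w == Some n) : diagram m n :=
  exist (fun w => is_true (cod m w == Some n)) w w_mn.

Fact compose_subproof l m n (g : diagram m n) (f : diagram l m) :
  cod l (val f ++ val g) == Some n.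
Proof. by rewrite cod_cat (eqP (valP f)) /= (eqP (valP g)). Qed.

(* [compose g f] is [g] stacked on top of [f]. *)
Definition compose l m n (g : diagram m n) (f : diagram l m) : diagram l n :=
  mk_diagram (compose_subproof g f).

Fact adjoint_subproof m n (f : diagram m n) : cod n (mirror (val f)) == Some m.
Proof. by rewrite (cod_mirror (eqP (valP f))). Qed.

Definition adjoint m n (f : diagram m n) : diagram n m :=
  mk_diagram (adjoint_subproof f).

(* The last string is carried below [w] to the first position.  Nothing has to
   be done when there is no boundary point. *)
Definition rotate_word (n : nat) (w : word) : word :=
  if n is 0%N then w else Slice 0 Cup :: shift 1 w ++ [:: Slice n Cap].

Fact rotate_subproof n (f : diagram 0 n) : cod 0 (rotate_word n (val f)) == Some n.
Proof.
case: n f => [|n] f; first exact: valP f.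
rewrite /rotate_word /= cod_cat (cod_shift 1 1 (eqP (valP f))) /= /slice_cod /=.
rewrite ifT; last by lia.
by apply/eqP; congr Some; lia.
Qed.

Definition rotate n (f : diagram 0 n) : diagram 0 n :=
  mk_diagram (rotate_subproof f).

(** * Skein theory *)

Section Skein.
Variables (R : realType) (d : R).
Local Notation C := R[i].

(* [relator m n r]: the combination [r] of words from [m] to [n] points is
   declared to vanish.  The first five families generate planar isotopy:
   exchange of heights, straightening of a string, and bending of a leg of
   a vertex; the other five are the skein relations. *)
Inductive relator : nat -> nat -> {freeg word / C} -> Prop :=
| rel_exchange g k h :
    relator (ins g + k + ins h)%N (outs g + k + outs h)%N
      (<< [:: Slice 0 g; Slice (outs g + k) h] >>
       - << [:: Slice (ins g + k) h; Slice 0 g] >>)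
| rel_zigzag_left :
    relator 1 1 (<< [:: Slice 1 Cup; Slice 0 Cap] >> - << [::] >>)
| rel_zigzag_right :
    relator 1 1 (<< [:: Slice 0 Cup; Slice 1 Cap] >> - << [::] >>)
| rel_bend_left :
    relator 1 2 (<< [:: Slice 0 Cup; Slice 1 Merge] >> - << [:: Slice 0 Split] >>)
| rel_bend_right :
    relator 1 2 (<< [:: Slice 1 Cup; Slice 0 Merge] >> - << [:: Slice 0 Split] >>)
| rel_loop :
    relator 0 0 (<< [:: Slice 0 Cup; Slice 0 Cap] >> - d%:C%C *: << [::] >>)
| rel_lollipop :
    relator 1 0 << [:: Slice 0 Split; Slice 0 Cap] >>
| rel_bigon :
    relator 1 1 (<< [:: Slice 0 Split; Slice 0 Merge] >> - << [::] >>)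
| rel_triangle :
    relator 1 2 (<< [:: Slice 0 Split; Slice 0 Split; Slice 1 Merge] >>
                 - ((d - 2) / (d - 1))%:C%C *: << [:: Slice 0 Split] >>)
| rel_I_H :
    relator 2 2 (<< [:: Slice 0 Merge; Slice 0 Split] >>
                 - << [:: Slice 0 Split; Slice 1 Merge] >>
                 - ((d - 1)^-1)%:C%C *:
                     (<< [::] >> - << [:: Slice 0 Cap; Slice 0 Cup] >>)).

(* [r] inserted in a larger diagram: [p] below, [q] above, [i] strings on its
   left. *)
Definition plug (p : word) (i : nat) (q : word) (r : {freeg word / C}) :
    {freeg word / C} :=
  fglift (fun u => << p ++ shift i u ++ q >> : {freeg word / C}) r.

(* The combinations of diagrams from [a] to [b] points that vanish by local
   application of the relations. *)
Inductive skein (a b : nat) : {freeg word / C} -> Prop :=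
| skein_rel m n r p i j q : relator m n r ->
    cod a p = Some (i + m + j)%N -> cod (i + n + j)%N q = Some b ->
    skein a b (plug p i q r)
| skein0 : skein a b 0
| skein_lin (c : C) x y : skein a b x -> skein a b y -> skein a b (c *: x + y).

(* The scalar [z] such that the closed diagram [w] is [z] times the empty
   diagram modulo [skein], i.e. the identification of C_0 with the complex
   numbers.  The default 0 is immaterial: [z] exists and is unique. *)
Definition evaluation (w : diagram 0 0) : C :=
  xget 0 [set z : C | skein 0 0 (<< val w >> - z *: << [::] >>)].

(* Linear in [x] and conjugate linear in [y]. *)
Definition gluing_form (k : nat) (x y : {freeg (diagram 0 k) / C}) : C :=
  \sum_(u <- dom x) \sum_(v <- dom y)
    coeff u x * (coeff v y)^* * evaluation (compose (adjoint v) u).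

Definition negligible (k : nat) : {pred {freeg (diagram 0 k) / C}} :=
  fun x => `[< forall y, gluing_form x y = 0 >].

Lemma fglift_sum (K : choiceType) (F : K -> C) (x : {freeg K / C}) :
  fglift (F : K -> C^o) x = \sum_(u <- dom x) coeff u x * F u.
Proof.
pose L := fglift (F : K -> C^o).
have LB : {morph L : a b / a - b} := lift_is_additive (F : K -> C^o).
have L0 : L 0 = 0 by rewrite -[0 in LHS](subrr 0) LB subrr.
have LD : {morph L : a b / a + b}.
  by move=> a b; rewrite -[b in LHS]opprK LB -[- b]sub0r LB L0 sub0r opprK.
rewrite -[x in LHS]freeg_sumE -/L (big_morph L LD L0).
by apply: eq_bigr => u _; rewrite /L liftU.
Qed.

Lemma fglift_lin (K : choiceType) (F : K -> C) c (x y : {freeg K / C}) :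
  fglift (F : K -> C^o) (c *: x + y)
  = c * fglift (F : K -> C^o) x + fglift (F : K -> C^o) y.
Proof.
pose L := fglift (F : K -> C^o).
have LB : {morph L : a b / a - b} := lift_is_additive (F : K -> C^o).
have L0 : L 0 = 0 by rewrite -[0 in LHS](subrr 0) LB subrr.
have LD : {morph L : a b / a + b}.
  by move=> a b; rewrite -[b in LHS]opprK LB -[- b]sub0r LB L0 sub0r opprK.
rewrite -/L LD; congr (_ + _).
rewrite (_ : c *: x = \sum_(u <- dom x) << c * coeff u x *g u >>) //.
rewrite (big_morph L LD L0) /L fglift_sum mulr_sumr.
by apply: eq_bigr => u _; rewrite liftU /GRing.scale /= mulrA.
Qed.

Lemma gluing_form_lin k (y : {freeg (diagram 0 k) / C}) c x1 x2 :
  gluing_form (c *: x1 + x2) y = c * gluing_form x1 y + gluing_form x2 y.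
Proof.
pose F u := \sum_(v <- dom y) (coeff v y)^* * evaluation (compose (adjoint v) u).
have formE x : gluing_form x y = fglift (F : _ -> C^o) x.
  rewrite fglift_sum; apply: eq_bigr => u _; rewrite mulr_sumr.
  by apply: eq_bigr => v _; rewrite mulrA.
by rewrite !formE fglift_lin.
Qed.

Fact negligible_zmod k : zmod_closed (@negligible k).
Proof.
have lin := @gluing_form_lin k.
have form0 (y : {freeg (diagram 0 k) / C}) : gluing_form 0 y = 0.
  by have := lin y (-1) 0 0; rewrite scaler0 addr0 mulN1r addNr.
split=> [|x1 x2 /asboolP x1N /asboolP x2N]; apply/asboolP => y //.
by rewrite addrC -scaleN1r lin x1N x2N mulr0 addr0.
Qed.

HB.instance Definition _ k :=
  GRing.isZmodClosed.Build _ (@negligible k) (@negligible_zmod k).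

(* The space C_k.  As [evaluation] is invariant under [skein], the relations
   are among the negligible combinations. *)
Definition Cspace (k : nat) := {ideal_quot (@negligible k)}.

HB.instance Definition _ k := GRing.Zmodule.on (Cspace k).
HB.instance Definition _ k := EqQuotient.on (Cspace k).

Definition cls k (x : {freeg (diagram 0 k) / C}) : Cspace k := \pi_(Cspace k)%qT x.

Definition Cspace_scale k (c : C) (x : Cspace k) : Cspace k := cls (c *: repr x).

Lemma clsE k (x y : {freeg (diagram 0 k) / C}) :
  (cls x == cls y) = negligible (x - y).
Proof. by rewrite /cls -Quotient.idealrBE. Qed.

Lemma reprK_cls k (x : Cspace k) : cls (repr x) = x.
Proof. exact: reprK. Qed.

Lemma clsD k : {morph @cls k : x y / x + y}.
Proof. by move=> x y; rewrite /cls !piE. Qed.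

Lemma cls_scale k c x : Cspace_scale c (cls x) = cls (c *: x) :> Cspace k.
Proof.
apply/eqP; rewrite clsE -scalerBr.
have : cls (repr (cls x)) == cls x by rewrite reprK_cls.
rewrite clsE => /asboolP xN; apply/asboolP => y.
have form0 : gluing_form 0 y = 0.
  by have := gluing_form_lin y (-1) 0 0; rewrite scaler0 addr0 mulN1r addNr.
by rewrite -[_ *: _]addr0 gluing_form_lin xN form0 mulr0 addr0.
Qed.

Fact Cspace_scaleA k c1 c2 (x : Cspace k) :
  Cspace_scale c1 (Cspace_scale c2 x) = Cspace_scale (c1 * c2) x.
Proof. by rewrite -[x]reprK_cls !cls_scale scalerA. Qed.

Fact Cspace_scale1 k : left_id 1 (@Cspace_scale k).
Proof. by move=> x; rewrite -[x]reprK_cls cls_scale scale1r. Qed.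

Fact Cspace_scaleDr k : right_distributive (@Cspace_scale k) +%R.
Proof.
move=> c x y; rewrite -[x]reprK_cls -[y]reprK_cls.
by rewrite -clsD !cls_scale scalerDr clsD.
Qed.

Fact Cspace_scaleDl k (x : Cspace k) : {morph (@Cspace_scale k)^~ x : a b / a + b}.
Proof.
by move=> a b; rewrite -[x]reprK_cls !cls_scale scalerDl clsD.
Qed.

HB.instance Definition _ k := GRing.Zmodule_isLmodule.Build C (Cspace k)
  (@Cspace_scaleA k) (@Cspace_scale1 k) (@Cspace_scaleDr k) (@Cspace_scaleDl k).

(* The inner product of C_k. *)
Definition pairing k (x y : Cspace k) : C := gluing_form (repr x) (repr y).

(* The map of C_m into C_n induced by a map of diagrams compatible with the
   relations. *)
Definition Cspace_map m n (h : diagram 0 m -> diagram 0 n) (x : Cspace m) : Cspace n :=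
  cls (fglift (fun u => << h u >> : {freeg (diagram 0 n) / C}) (repr x)).

Definition rho k : Cspace k -> Cspace k := Cspace_map (@rotate k).

End Skein.

(** * Trees, forests and Thompson's group T *)

Inductive btree := Leaf | Node of btree & btree.

Fixpoint leaves (t : btree) : nat :=
  if t is Node l r then (leaves l + leaves r)%N else 1%N.

Lemma leaves_gt0 t : (0 < leaves t)%N.
Proof. by elim: t => //= l IHl r _; rewrite addn_gt0 IHl. Qed.

Definition tree (n : nat) := {t : btree | leaves t == n}.

Definition forest (m n : nat) :=
  {f : seq btree | (size f == m) && (sumn (map leaves f) == n)}.

Fixpoint graft_btree (f : seq btree) (s : btree) : btree :=
  if s is Node l r
  then Node (graft_btree (take (leaves l) f) l) (graft_btree (drop (leaves l) f) r)
  else head Leaf f.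

Lemma leaves_graft f s :
  size f = leaves s -> leaves (graft_btree f s) = sumn (map leaves f).
Proof.
elim: s f => [|l IHl r IHr] f /=; first by case: f => [|t [|]] //=; rewrite addn0.
move=> szf.
have szl : size (take (leaves l) f) = leaves l by rewrite size_takel // szf leq_addr.
have szr : size (drop (leaves l) f) = leaves r by rewrite size_drop szf addKn.
by rewrite IHl // IHr // -sumn_cat -map_cat cat_take_drop.
Qed.

Fact graft_subproof m n (f : forest m n) (s : tree m) :
  leaves (graft_btree (val f) (val s)) == n.
Proof.
case: f s => f /= /andP[/eqP szf /eqP fn] [s /= /eqP sm].
by rewrite leaves_graft ?szf ?sm ?fn.
Qed.

(* The tree [f s], obtained by attaching the roots of [f] to the leaves of [s]. *)
Definition graft m n (f : forest m n) (s : tree m) : tree n :=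
  exist (fun t => is_true (leaves t == n)) _ (graft_subproof f s).

(* [t] drawn with its root at the bottom, on string number [i]. *)
Fixpoint btree_word (i : nat) (t : btree) : word :=
  if t is Node l r
  then Slice i Split :: btree_word i.+1 r ++ btree_word i l else [::].

(* The trees of [f] drawn side by side on the strings [i], [i + 1], ... *)
Fixpoint forest_word (i : nat) (f : seq btree) : word :=
  if f is t :: f' then forest_word i.+1 f' ++ btree_word i t else [::].

Lemma cod_btree_word i t n :
  (i < n)%N -> cod n (btree_word i t) = Some (n.-1 + leaves t)%N.
Proof.
elim: t i n => [|l IHl r IHr] i n lt_in /=; first by congr Some; lia.
rewrite /slice_cod /= ifT; last by lia.
rewrite /= cod_cat IHr /=; last by lia.
by rewrite IHl; [congr Some; have := leaves_gt0 r; lia | have := leaves_gt0 r; lia].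
Qed.

Lemma cod_forest_word i f n : (i + size f <= n)%N ->
  cod n (forest_word i f) = Some (n - size f + sumn (map leaves f))%N.
Proof.
elim: f i n => [|t f IHf] i n /= le_n; first by congr Some; lia.
rewrite cod_cat IHf /=; last by lia.
by rewrite cod_btree_word; [congr Some; lia | lia].
Qed.

Fact forest_subproof m n (f : forest m n) : cod m (forest_word 0 (val f)) == Some n.
Proof.
case: f => f /= /andP[/eqP szf /eqP fn].
by rewrite cod_forest_word szf ?subnn ?fn.
Qed.

(* The diagram of [f], each branching being the vertex Y. *)
Definition forest_diagram m n (f : forest m n) : diagram m n :=
  mk_diagram (forest_subproof f).

Section Thompson.
Variable R : realType.

(* The standard dyadic intervals [a, a + w) of the leaves of [t], given as
   pairs (a, w), when the root stands for [a, a + w). *)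
Fixpoint dyadic_intervals (a w : R) (t : btree) : seq (R * R) :=
  if t is Node l r
  then dyadic_intervals a (w / 2) l ++ dyadic_intervals (a + w / 2) (w / 2) r
  else [:: (a, w)].

(* The homeomorphism of the circle represented by (s, k, t).  The circle is
   [0, 1); the map is extended to R by the identity. *)
Definition thompson_map n (s : tree n) (k : 'I_n) (t : tree n) (x : R) : R :=
  let I := dyadic_intervals 0 1 (val t) in
  let J := dyadic_intervals 0 1 (val s) in
  let i := find (fun aw => aw.1 <= x < aw.1 + aw.2) I in
  if (i < n)%N then
    let: (a, w) := nth (0, 1) I i in
    let: (b, v) := nth (0, 1) J ((i + k) %% n) in
    b + (x - a) * (v / w)
  else x.

Definition thompsonT : set (R -> R) :=
  [set g | exists n (s : tree n) (k : 'I_n) (t : tree n), g = thompson_map s k t].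

End Thompson.

Arguments thompsonT : clear implicits.

(** * The direct limit representation *)

Section Representation.
Variables (R : realType) (d : R).
Local Notation C := R[i].

(* The connecting map x |-> Phi(f) o x. *)
Definition forest_map m n (f : forest m n) : Cspace d m -> Cspace d n :=
  Cspace_map (compose (forest_diagram f)).

Variables (H : completeNormedModType C) (ip : {dot H for (@Num.conj C)}).

(* The norm of [H] comes from the inner product [ip], so that [H] is a Hilbert
   space. *)
Definition hilbert_norm : Prop := forall v : H, `|v| ^+ 2 = ip v v.

(* [H] is the Hilbert space completion of the direct limit over the directed
   set of trees of the spaces [Cspace d n], [iota t x] being the class t/x. *)
Record direct_limit_completion
    (iota : forall n, tree n -> {linear Cspace d n -> H}) : Prop := {
  limit_isometry : forall n (t : tree n) (x y : Cspace d n),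
    ip (iota n t x) (iota n t y) = pairing x y;
  limit_connect : forall m n (s : tree m) (f : forest m n) (x : Cspace d m),
    iota n (graft f s) (forest_map f x) = iota m s x;
  limit_dense :
    closure [set v | exists n (t : tree n) (x : Cspace d n), v = iota n t x] = setT
}.

(* [U], restricted to T, is the unitary representation pi_Y. *)
Record thompson_representation
    (iota : forall n, tree n -> {linear Cspace d n -> H})
    (U : (R -> R) -> {linear H -> H}) : Prop := {
  rep_unitary : forall g, thompsonT R g ->
    (forall u v, ip (U g u) (U g v) = ip u v) /\ (forall v, exists u, U g u = v);
  rep_id : U id =1 id;
  rep_comp : forall g h, thompsonT R g -> thompsonT R h -> U (g \o h) =1 U g \o U h;
  rep_limit : forall n (s : tree n) (k : 'I_n) (t : tree n) (x : Cspace d n),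
    U (thompson_map s k t) (iota n t x) = iota n s (iter k (@rho R d n) x)
}.

Definition caret : tree 2 :=
  exist (fun t => is_true (leaves t == 2%N)) (Node Leaf Leaf) isT.

Definition strand : diagram 0 2 := @mk_diagram 0 2 [:: Slice 0 Cup] isT.

Definition vacuum (iota : forall n, tree n -> {linear Cspace d n -> H}) : H :=
  iota 2 caret (((Num.sqrt d)^-1)%:C%C *: cls d << strand >>).

End Representation.

(** * Irreducibility *)

Section Irreducibility.
Variables (K : numFieldType) (H : normedModType K).

Definition linear_span (A : set H) : set H :=
  [set v | exists n (a : 'I_n -> K) (u : 'I_n -> H),
     (forall i, A (u i)) /\ v = \sum_(i < n) a i *: u i].

Definition closed_span (A : set H) : set H := closure (linear_span A).

Definition closed_subspace (W : set H) : Prop :=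
  [/\ W 0, (forall (a : K) u v, W u -> W v -> W (a *: u + v)) & closed W].

Definition stable_under (S : set (H -> H)) (W : set H) : Prop :=
  forall T, S T -> forall v, W v -> W (T v).

(* The operators in [S] act irreducibly on the closed subspace [V]. *)
Definition acts_irreducibly (S : set (H -> H)) (V : set H) : Prop :=
  [/\ closed_subspace V, V <> [set 0], stable_under S V &
      forall W, closed_subspace W -> W `<=` V -> stable_under S W ->
        W = [set 0] \/ W = V].

End Irreducibility.

(* Main.v *)
Require Import Defs.
From HB Require Import structures.
From mathcomp Require Import all_boot all_order all_algebra.
From mathcomp Require Import sesquilinear generic_quotient ring_quotient.
From mathcomp Require Import all_classical all_reals all_analysis.
From mathcomp Require Import complex freeg zify ring lra.
Require Import Defs.

Set Implicit Arguments.
Unset Strict Implicit.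
Unset Printing Implicit Defensive.

Import Order.TTheory GRing.Theory Num.Theory.
Import numFieldNormedType.Exports.

Local Open Scope classical_set_scope.
Local Open Scope ring_scope.

(* Let [t] be a tree with [n] leaves, with the root removed: it is a planar tree
   joining the [n] boundary points, and the vacuum is [d^(-1/2)] times this
   diagram, for every [t].  Seen from its first (last) leaf it is a rooted tree
   [r'] ([r]) with [n - 1] leaves.  Let [g] be the element of F that takes [t]
   with [r] on its first leaf to [t] with [r'] on its last leaf.  In the inner
   product of [g (t/x)] with [t/y], all strings of [x] but the first are absorbed
   by the adjoint of [r'], all strings of [y] but the last by [r], and two
   elements of the one-dimensional space C_2 are left; hence
     <g (t/x), t/y> = <t/x, vacuum> <vacuum, t/y>.
   By density the projection to the vacuum is a weak limit of elements of T, so a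
   closed invariant subspace contains the vacuum or is orthogonal to its orbit.

   That C_2 is at most one-dimensional follows from the skein relations, which
   reduce every diagram without bottom points to a combination of diagrams made
   of cups and branchings only.  That the relations do not collapse, so that the
   evaluation is the intended one, follows from a state sum: the quantum SL(2)
   invariant with [X] the three-dimensional representation. *)

(** * Reduction of diagrams *)

Section FreeModule.
Variables (A : nzRingType) (K : choiceType).
Implicit Type x : {freeg K / A}.

Fact fglift_is_linear (M : lmodType A) (f : K -> M) :
  linear (fglift f : {freeg K / A} -> M).
Proof.
pose L := fglift f : {freeg K / A} -> M.
have LB : {morph L : a b / a - b} := lift_is_additive f.
have L0 : L 0 = 0 by rewrite -[0 in LHS](subrr 0) LB subrr.
have LD : {morph L : a b / a + b}.
  by move=> a b; rewrite -[b in LHS]opprK LB -[- b]sub0r LB L0 sub0r opprK.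
move=> c x y; rewrite -/L LD; congr (_ + _).
rewrite (_ : c *: x = \sum_(u <- dom x) << c * coeff u x *g u >>) //.
rewrite -[x in RHS]freeg_sumE !(big_morph L LD L0) scaler_sumr.
by apply: eq_bigr => u _; rewrite /L !liftU scalerA.
Qed.

HB.instance Definition _ (M : lmodType A) (f : K -> M) :=
  GRing.isLinear.Build A {freeg K / A} M _ (fglift f) (fglift_is_linear f).

Lemma fgliftU (M : lmodType A) (f : K -> M) u : fglift f << u >> = f u.
Proof. by rewrite liftU scale1r. Qed.

Lemma fglift_unique (M : lmodType A) (L : {linear {freeg K / A} -> M}) x :
  L x = fglift (fun u => L << u >>) x.
Proof.
rewrite -[x in LHS]freeg_sumE linear_sum -[x in RHS]freeg_sumE linear_sum /=.
apply: eq_bigr => u _; rewrite liftU -linearZ; congr (L _).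
apply/eqP/freeg_eqP => v; rewrite coeffZ !coeffU /=.
by rewrite mul1r.
Qed.

End FreeModule.

Lemma fglift_comp (A : nzRingType) (K K' : choiceType) (M : lmodType A)
    (f : K' -> M) (h : K -> K') (x : {freeg K / A}) :
  fglift f (fglift (fun u => << h u >> : {freeg K' / A}) x) = fglift (f \o h) x.
Proof.
rewrite -[x in LHS]freeg_sumE -[x in RHS]freeg_sumE !linear_sum /=.
apply: eq_bigr => u _; rewrite !liftU linearZ /= fgliftU //.
Qed.

Section SkeinReduction.
Variables (R : realType) (d : R).
Local Notation C := R[i].
Local Notation FW := {freeg word / C}.
Local Notation skein := (@skein R d).
Local Notation relator := (@relator R d).
Local Notation plug := (@plug R).

HB.instance Definition _ p i q :=
  GRing.isLinear.Build C FW FW _ (plug p i q) (fglift_is_linear _).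

Lemma plugU p i q u : plug p i q (<< u >> : FW) = << p ++ shift i u ++ q >>.
Proof. exact: fgliftU. Qed.

Lemma shift0 u : shift 0 u = u.
Proof. by rewrite /shift -[RHS]map_id; apply: eq_map => -[]. Qed.

Lemma shift_cat i u v : shift i (u ++ v) = shift i u ++ shift i v.
Proof. exact: map_cat. Qed.

Lemma shift_shift i j u : shift i (shift j u) = shift (i + j) u.
Proof. by rewrite /shift -map_comp; apply: eq_map => s /=; rewrite addnA. Qed.

Lemma plug_plug p i q p' i' q' (x : FW) :
  plug p i q (plug p' i' q' x) = plug (p ++ shift i p') (i + i') (shift i q' ++ q) x.
Proof.
rewrite /plug fglift_comp; congr fglift; apply/funext => u /=; congr << _ >>.
by rewrite !shift_cat shift_shift -!catA.
Qed.

Lemma skeinZ a b c x : skein a b x -> skein a b (c *: x).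
Proof. by move=> sx; rewrite -[_ *: _]addr0; apply: skein_lin => //; apply: skein0. Qed.

Lemma skeinD a b x y : skein a b x -> skein a b y -> skein a b (x + y).
Proof. by move=> sx sy; rewrite -[x]scale1r; apply: skein_lin. Qed.

Lemma skeinN a b x : skein a b x -> skein a b (- x).
Proof. by move=> sx; rewrite -scaleN1r; apply: skeinZ. Qed.

(** The relations are local: a relator inserted in a diagram that is itself inserted in a larger one
    is a single insertion, by [plug_plug]. *)
Lemma skein_plug m n a b x p i j q : skein m n x ->
  cod a p = Some (i + m + j)%N -> cod (i + n + j)%N q = Some b ->
  skein a b (plug p i q x).
Proof.
move=> sx cp cq; elim: {x} sx.
- move=> m' n' r p' i' j' q' rr cp' cq'; rewrite plug_plug.
  apply: (@skein_rel _ _ _ _ m' n' _ _ _ (j' + j)%N) => //.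
    by rewrite cod_cat cp /= (cod_shift i j cp'); congr Some; lia.
  rewrite cod_cat.
  have -> : (i + i' + n' + (j' + j) = i + (i' + n' + j') + j)%N by lia.
  by rewrite (cod_shift i j cq').
- by rewrite linear0; apply: skein0.
- by move=> c x y _ sx _ sy; rewrite linearP; apply: skein_lin.
Qed.

Definition weq a b (u v : word) := skein a b (<< u >> - << v >>).

Lemma weq_sym a b u v : weq a b u v -> weq a b v u.
Proof. by move=> /skeinN; rewrite opprB. Qed.

Lemma weq_trans a b v u w : weq a b u v -> weq a b v w -> weq a b u w.
Proof. by move=> h1 h2; have := skeinD h1 h2; rewrite addrA subrK. Qed.

Lemma skein_insert m n x a b p i q c : skein m n x -> cod a p = Some c ->
  (i + m <= c)%N -> cod (c - m + n)%N q = Some b -> skein a b (plug p i q x).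
Proof.
move=> sx cp le_c cq; apply: (@skein_plug m n a b x p i (c - (i + m))%N q) => //.
  by rewrite cp; congr Some; lia.
by rewrite -cq; congr cod; lia.
Qed.

Lemma weq_insert m n u v a b p i q c : weq m n u v -> cod a p = Some c ->
  (i + m <= c)%N -> cod (c - m + n)%N q = Some b ->
  weq a b (p ++ shift i u ++ q) (p ++ shift i v ++ q).
Proof.
move=> uv cp le_c cq; have := skein_insert uv cp le_c cq.
by rewrite linearB /= !plugU.
Qed.

Lemma skein_of_relator m n x : relator m n x -> skein m n x.
Proof.
move=> rx; have := @skein_rel R d m n m n x [::] 0 0 [::] rx.
rewrite !add0n !addn0; move=> /(_ erefl erefl).
suff -> : plug [::] 0 [::] x = x by [].
transitivity (fglift (fun u : word => << u >> : FW) x).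
  by congr fglift; apply/funext => u; rewrite cats0 shift0.
exact/esym/(fglift_unique idfun x).
Qed.

(** * Planar consequences of the relators *)

Lemma weq_exchange g k h :
  weq (ins g + k + ins h)%N (outs g + k + outs h)%N
      [:: Slice 0 g; Slice (outs g + k) h] [:: Slice (ins g + k) h; Slice 0 g].
Proof. exact/skein_of_relator/rel_exchange. Qed.

Lemma weq_zigzag_left : weq 1 1 [:: Slice 1 Cup; Slice 0 Cap] [::].
Proof. exact/skein_of_relator/rel_zigzag_left. Qed.

Lemma weq_zigzag_right : weq 1 1 [:: Slice 0 Cup; Slice 1 Cap] [::].
Proof. exact/skein_of_relator/rel_zigzag_right. Qed.

Lemma weq_bend_left : weq 1 2 [:: Slice 0 Cup; Slice 1 Merge] [:: Slice 0 Split].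
Proof. exact/skein_of_relator/rel_bend_left. Qed.

Lemma weq_bend_right : weq 1 2 [:: Slice 1 Cup; Slice 0 Merge] [:: Slice 0 Split].
Proof. exact/skein_of_relator/rel_bend_right. Qed.

Lemma weq_bigon : weq 1 1 [:: Slice 0 Split; Slice 0 Merge] [::].
Proof. exact/skein_of_relator/rel_bigon. Qed.

(** Write the branching as a cup followed by a merge, slide the cap below the merge, and straighten
    the resulting zigzag. *)
Lemma weq_cap_split_left : weq 2 1 [:: Slice 1 Split; Slice 0 Cap] [:: Slice 0 Merge].
Proof.
apply: (@weq_trans _ _ [:: Slice 1 Cup; Slice 2 Merge; Slice 0 Cap]).
  exact/weq_sym/(@weq_insert _ _ _ _ 2 1 [::] 1 [:: Slice 0 Cap] 2 weq_bend_left).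
apply: (@weq_trans _ _ [:: Slice 1 Cup; Slice 0 Cap; Slice 0 Merge]).
  exact/weq_sym/(@weq_insert _ _ _ _ 2 1 [:: Slice 1 Cup] 0 [::] 4
    (weq_exchange Cap 0 Merge)).
exact: (@weq_insert _ _ _ _ 2 1 [::] 0 [:: Slice 0 Merge] 2 weq_zigzag_left).
Qed.

Lemma weq_cap_split_right : weq 2 1 [:: Slice 0 Split; Slice 1 Cap] [:: Slice 0 Merge].
Proof.
apply: (@weq_trans _ _ [:: Slice 1 Cup; Slice 0 Merge; Slice 1 Cap]).
  exact/weq_sym/(@weq_insert _ _ _ _ 2 1 [::] 0 [:: Slice 1 Cap] 2 weq_bend_right).
apply: (@weq_trans _ _ [:: Slice 1 Cup; Slice 2 Cap; Slice 0 Merge]).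
  exact/(@weq_insert _ _ _ _ 2 1 [:: Slice 1 Cup] 0 [::] 4 (weq_exchange Merge 0 Cap)).
exact: (@weq_insert _ _ _ _ 2 1 [::] 1 [:: Slice 0 Merge] 2 weq_zigzag_right).
Qed.

(** Both sides are the same cup placed between the two strings, its ends being merged with them in
    one order of heights or the other. *)
Lemma weq_H_mirror :
  weq 2 2 [:: Slice 1 Split; Slice 0 Merge] [:: Slice 0 Split; Slice 1 Merge].
Proof.
apply: (@weq_trans _ _ [:: Slice 1 Cup; Slice 2 Merge; Slice 0 Merge]).
  exact/weq_sym/(@weq_insert _ _ _ _ 2 2 [::] 1 [:: Slice 0 Merge] 2 weq_bend_left).
apply: (@weq_trans _ _ [:: Slice 1 Cup; Slice 0 Merge; Slice 1 Merge]).
  exact/weq_sym/(@weq_insert _ _ _ _ 2 2 [:: Slice 1 Cup] 0 [::] 4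
    (weq_exchange Merge 0 Merge)).
exact: (@weq_insert _ _ _ _ 2 2 [::] 0 [:: Slice 1 Merge] 2 weq_bend_right).
Qed.

Lemma weq_cup_split : weq 0 3 [:: Slice 0 Cup; Slice 0 Split] [:: Slice 0 Cup; Slice 1 Split].
Proof.
apply: (@weq_trans _ _ [:: Slice 0 Cup; Slice 0 Cup; Slice 1 Merge]).
  exact/weq_sym/(@weq_insert _ _ _ _ 0 3 [:: Slice 0 Cup] 0 [::] 2 weq_bend_left).
apply: (@weq_trans _ _ [:: Slice 0 Cup; Slice 2 Cup; Slice 1 Merge]).
  exact/weq_sym/(@weq_insert _ _ _ _ 0 3 [::] 0 [:: Slice 1 Merge] 0
    (weq_exchange Cup 0 Cup)).
exact: (@weq_insert _ _ _ _ 0 3 [:: Slice 0 Cup] 1 [::] 2 weq_bend_right).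
Qed.

(** Only the lollipop with its stick at the bottom is a relator. For the reflected one, the merge is
    written as a branching with one leg capped, and the branching slides along the cup to its other
    end, where it carries a lollipop. *)
Lemma skein_merge_cup : skein 0 1 << [:: Slice 0 Cup; Slice 0 Merge] >>.
Proof.
have lolli : skein 0 1 << [:: Slice 0 Cup; Slice 1 Split; Slice 1 Cap] >>.
  have := @skein_insert _ _ _ 0 1 [:: Slice 0 Cup] 1 [::] 2
    (skein_of_relator (@rel_lollipop R d)).
  by rewrite plugU; apply.
rewrite -[X in skein 0 1 X]
  (subrK << [:: Slice 0 Cup; Slice 1 Split; Slice 1 Cap] >>).
apply: skeinD lolli.
apply: (@weq_trans _ _ [:: Slice 0 Cup; Slice 0 Split; Slice 1 Cap]).
  exact/weq_sym/(@weq_insert _ _ _ _ 0 1 [:: Slice 0 Cup] 0 [::] 2 weq_cap_split_right).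
exact: (@weq_insert _ _ _ _ 0 1 [::] 0 [:: Slice 1 Cap] 0 weq_cup_split).
Qed.

Definition upward (s : slice) :=
  match body s with Cup | Split => true | _ => false end.

(** The combinations that the skein relations bring to cups and branchings. Words in these pieces
    only widen, so very few of them have 0 or 2 top points. *)
Inductive reducible (n : nat) : FW -> Prop :=
| red_word w : all upward w -> cod 0 w = Some n -> reducible n << w >>
| red_skein x : skein 0 n x -> reducible n x
| red_lin (c : C) x y : reducible n x -> reducible n y -> reducible n (c *: x + y).

Lemma redD n x y : reducible n x -> reducible n y -> reducible n (x + y).
Proof. by move=> rx ry; rewrite -[x]scale1r; apply: red_lin. Qed.

Lemma redZ n c x : reducible n x -> reducible n (c *: x).
Proof.
by move=> rx; rewrite -[_ *: _]addr0; apply: red_lin => //; apply/red_skein/skein0.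
Qed.

Lemma red_weq n u v : weq 0 n u v -> reducible n << v >> -> reducible n << u >>.
Proof.
move=> uv rv; rewrite -[X in reducible n X](subrK << v >>).
by apply: redD rv; apply: red_skein.
Qed.

Lemma red_push n m s x : upward s -> slice_cod n s = Some m ->
  reducible n x -> reducible m (plug [::] 0 [:: s] x).
Proof.
move=> us cs; elim=> [w uw cw|{}x sx|c {}x y _ rx _ ry].
- rewrite plugU /= shift0; apply: red_word; first by rewrite all_cat uw /= us.
  by rewrite cod_cat cw /= cs.
- by apply: red_skein; apply: (@skein_plug _ _ _ _ _ _ _ 0 _ sx) => //=;
    rewrite ?add0n ?addn0 // cs.
- by rewrite linearP; apply: red_lin.
Qed.

(** A cap or a merge lying wholly to the left of the last piece is slid below it; that piece is then
    set on top of a combination already reduced, by [red_push]. *)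
Lemma red_comm_left n w u dn i j : cod 0 w = Some n -> upward (Slice j u) ->
  ~~ upward (Slice i dn) -> (i + 2 <= j)%N -> (j + ins u <= n)%N ->
  reducible (n - 2 + outs dn)%N << w ++ [:: Slice i dn] >> ->
  reducible (n - ins u + outs u - 2 + outs dn)%N << w ++ [:: Slice j u; Slice i dn] >>.
Proof.
move=> cw uu ud ij jn rw.
have i2 : ins dn = 2%N by case: dn ud {rw}.
set n' := (n - ins u + outs u - 2 + outs dn)%N.
pose j' := (j - 2 + outs dn)%N.
have eqw : weq 0 n' (w ++ [:: Slice j u; Slice i dn]) (w ++ [:: Slice i dn; Slice j' u]).
  have := @weq_insert _ _ _ _ 0 n' w i [::] n (weq_exchange dn (j - 2 - i) u) cw.
  rewrite i2 /= /shift /= !addn0.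
  have -> : (i + (outs dn + (j - 2 - i)) = j')%N by rewrite /j'; lia.
  have -> : (i + (2 + (j - 2 - i)) = j)%N by lia.
  move=> H; apply: weq_sym; apply: H; first by lia.
  by congr Some; rewrite /n'; lia.
apply: (red_weq eqw).
have := @red_push _ n' (Slice j' u) _ uu _ rw; rewrite plugU shift0 -catA; apply.
rewrite /slice_cod /= ifT; last by rewrite /j'; lia.
by congr Some; rewrite /n'; lia.
Qed.

Lemma red_comm_right n w u dn i j : cod 0 w = Some n -> upward (Slice j u) ->
  ~~ upward (Slice i dn) -> (j + outs u <= i)%N -> (i + 2 <= n - ins u + outs u)%N ->
  (j + ins u <= n)%N ->
  reducible (n - 2 + outs dn)%N << w ++ [:: Slice (i - outs u + ins u) dn] >> ->
  reducible (n - ins u + outs u - 2 + outs dn)%N << w ++ [:: Slice j u; Slice i dn] >>.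
Proof.
move=> cw uu ud ij in' jn rw.
have i2 : ins dn = 2%N by case: dn ud {rw}.
set n' := (n - ins u + outs u - 2 + outs dn)%N.
pose i' := (i - outs u + ins u)%N.
have eqw : weq 0 n' (w ++ [:: Slice j u; Slice i dn]) (w ++ [:: Slice i' dn; Slice j u]).
  have := @weq_insert _ _ _ _ 0 n' w j [::] n (weq_exchange u (i - outs u - j) dn) cw.
  rewrite i2 /= /shift /= !addn0.
  have -> : (j + (outs u + (i - outs u - j)) = i)%N by lia.
  have -> : (j + (ins u + (i - outs u - j)) = i')%N by rewrite /i'; lia.
  move=> H; apply: H; first by lia.
  by congr Some; rewrite /n'; lia.
apply: (red_weq eqw).
have := @red_push _ n' (Slice j u) _ uu _ rw; rewrite plugU shift0 -catA; apply.
rewrite /slice_cod /= ifT; last by lia.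
by congr Some; rewrite /n'; lia.
Qed.

Lemma red_subst m n u y w i c n' : skein m n (<< u >> - y) -> cod 0 w = Some c ->
  (i + m <= c)%N -> (c - m + n = n')%N ->
  reducible n' (plug w i [::] y) -> reducible n' << w ++ shift i u >>.
Proof.
move=> suy cw le_c <- ry.
have := red_skein (skein_insert (q := [::]) suy cw le_c erefl).
rewrite linearB /= plugU cats0 => /redD /(_ ry); rewrite subrK; exact.
Qed.

Lemma skein_loop :
  skein 0 0 (<< [:: Slice 0 Cup; Slice 0 Cap] >> - d%:C%C *: << [::] >>).
Proof. exact/skein_of_relator/rel_loop. Qed.

Lemma skein_lollipop : skein 1 0 << [:: Slice 0 Split; Slice 0 Cap] >>.
Proof. exact/skein_of_relator/rel_lollipop. Qed.

Lemma skein_H :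
  skein 2 2 (<< [:: Slice 0 Split; Slice 1 Merge] >>
             - (<< [:: Slice 0 Merge; Slice 0 Split] >>
                - ((d - 1)^-1)%:C%C *: (<< [::] >> - << [:: Slice 0 Cap; Slice 0 Cup] >>))).
Proof.
have := skeinN (skein_of_relator (@rel_I_H R d)).
by rewrite opprB opprB addrCA -opprB; congr (skein _ _ (_ - _)); rewrite opprB.
Qed.

(* An upward diagram absorbs a cap or a merge placed on top of it: commute it
   down to a slice that it touches, and use the relation of the two pieces.
   Capping a leg of a branching is a merge, and merging a leg of a branching
   is the relation I - H. *)
Lemma red_down n w : all upward w -> cod 0 w = Some n -> forall i, (i + 2 <= n)%N ->
  [/\ reducible (n - 2)%N << w ++ [:: Slice i Cap] >>
    & reducible (n - 1)%N << w ++ [:: Slice i Merge] >>].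
Proof.
elim/last_ind: w n => [|w [j g] IH] n /=; first by move=> _ [<-] i; lia.
rewrite all_rcons => /andP[ug uw]; rewrite -cats1 cod_cat.
case cw: (cod 0 w) => [m|] //=; rewrite /slice_cod /=; case: leqP => //= jm [<-] i.
move=> in'; rewrite -!catA /=.
have {}IH k : (k + 2 <= m)%N -> [/\ reducible (m - 2)%N << w ++ [:: Slice k Cap] >>
    & reducible (m - 1)%N << w ++ [:: Slice k Merge] >>] by exact: IH.
have rw : reducible m << w >> by exact: red_word.
have capE k : (k + 2 <= m)%N -> reducible (m - 2 + outs Cap)%N << w ++ [:: Slice k Cap] >>.
  by rewrite addn0 => /IH[].
have mergeE k : (k + 2 <= m)%N ->
    reducible (m - 2 + outs Merge)%N << w ++ [:: Slice k Merge] >>.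
  by move=> km; have [_] := IH _ km; congr reducible => /=; lia.
have [ij|ij] := leqP (i + 2) j.
  split.
    by rewrite -[(_ - 2)%N]addn0; apply: (@red_comm_left m w g Cap) => //; apply: capE; lia.
  have -> : (m - ins g + outs g - 1 = m - ins g + outs g - 2 + outs Merge)%N
    by rewrite /=; lia.
  by apply: (@red_comm_left m w g Merge) => //; apply: mergeE; lia.
have [ij'|ij'] := leqP (j + outs g) i.
  split; first rewrite -[(_ - 2)%N]addn0.
    apply: (@red_comm_right m w g Cap) => //; apply: capE; lia.
  have -> : (m - ins g + outs g - 1 = m - ins g + outs g - 2 + outs Merge)%N
    by rewrite /=; lia.
  by apply: (@red_comm_right m w g Merge) => //; apply: mergeE; lia.
(* H is traded through I - H for I, two strings, and a cup over a cap: in these at most one cap or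
   merge sits directly on [w], where induction applies. *)
have redH k : (k + 2 <= m)%N ->
    reducible m << w ++ [:: Slice k Split; Slice k.+1 Merge] >>.
  move=> km; have [capk mergek] := IH _ km.
  have : reducible m << w ++ shift k [:: Slice 0 Split; Slice 1 Merge] >>; last first.
    by rewrite /shift /= !addn0 !addn1.
  apply: (red_subst skein_H cw) => //; first by lia.
  rewrite linearB linearZ linearB /= !plugU !cats0 /shift /= !addn0 -scaleN1r.
  have red_up g' m' x : (k + ins g' <= m')%N -> upward (Slice k g') ->
      (m' - ins g' + outs g' = m)%N -> reducible m' x ->
      reducible m (plug [::] 0 [:: Slice k g'] x).
    by move=> le_m' ug' <-; apply: red_push; rewrite // /slice_cod /= le_m'.
  apply: redD; last apply/redZ/redZ/redD => //.
    have := red_up Split _ _ _ _ _ mergek; rewrite plugU shift0 -catA /= => H; apply: H => //=; lia.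
  rewrite -scaleN1r; apply: redZ.
  have := red_up Cup _ _ _ _ _ capk; rewrite plugU shift0 -catA /= => H; apply: H => //=; lia.
have sub0 p q u : skein p q << u >> -> skein p q (<< u >> - 0) by rewrite subr0.
(* The pieces share two strings, or one on either side. The bullets treat in turn a cup below a cap
   and a merge, then a branching below a cap and a merge. *)
have [eij|[eij|eij]] : (i = j \/ i = j.+1 \/ j = i.+1)%N by case: (g) ug ij' => //=; lia.
- subst i; case: g {IH} ug jm in' ij' => //= _ jm in' ij'; split.
  + have := @red_subst _ _ _ _ w j m (m - 0 + 2 - 2)%N skein_loop cw.
    rewrite /shift /= !addn0; apply; try lia.
    rewrite linearZ /= plugU cats0 cats0; apply: redZ; congr (reducible _ _): rw; lia.
  + have := @red_subst _ _ _ _ w j m (m - 0 + 2 - 1)%N (sub0 _ _ _ skein_merge_cup) cw.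
    rewrite /shift /= !addn0 linear0; apply; try lia.
    exact/red_skein/skein0.
  + have := @red_subst _ _ _ _ w j m (m - 1 + 2 - 2)%N (sub0 _ _ _ skein_lollipop) cw.
    rewrite /shift /= !addn0 linear0; apply; try lia.
    exact/red_skein/skein0.
  + have := @red_subst _ _ _ _ w j m (m - 1 + 2 - 1)%N weq_bigon cw.
    rewrite /shift /= !addn0 plugU !cats0; apply; try lia.
    by congr (reducible _ _): rw; lia.
- subst i; case: g {IH} ug jm in' ij' => //= _ jm in' ij'; split.
  + have := @red_subst _ _ _ _ w j m (m - 0 + 2 - 2)%N weq_zigzag_right cw.
    rewrite /shift /= !addn0 !addn1 plugU /= ?cats0; apply; try lia.
    by congr (reducible _ _): rw; lia.
  + have := @red_subst _ _ _ _ w j m (m - 0 + 2 - 1)%N weq_bend_left cw.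
    rewrite plugU /shift /= ?cats0 !addn0 !addn1; apply; try lia.
    apply: red_word; rewrite ?all_cat ?uw //= cod_cat cw /= /slice_cod /= ifT; last lia.
    by congr Some; lia.
  + have := @red_subst _ _ _ _ w j m (m - 1 + 2 - 2)%N weq_cap_split_right cw.
    rewrite plugU /shift /= ?cats0 !addn0 !addn1; apply; try lia.
    have := mergeE j; rewrite /= => H.
    by have {}H := H ltac:(lia); congr (reducible _ _): H; lia.
  + have {}redH := redH j ltac:(lia).
    by congr (reducible _ _): redH; lia.
- subst j; case: g {IH} ug jm in' ij' ij => //= _ jm in' ij' ij; split.
  + have := @red_subst _ _ _ _ w i m (m - 0 + 2 - 2)%N weq_zigzag_left cw.
    rewrite /shift /= !addn0 !addn1 plugU /= ?cats0; apply; try lia.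
    by congr (reducible _ _): rw; lia.
  + have := @red_subst _ _ _ _ w i m (m - 0 + 2 - 1)%N weq_bend_right cw.
    rewrite plugU /shift /= ?cats0 !addn0 !addn1; apply; try lia.
    apply: red_word; rewrite ?all_cat ?uw //= cod_cat cw /= /slice_cod /= ifT; last lia.
    by congr Some; lia.
  + have := @red_subst _ _ _ _ w i m (m - 1 + 2 - 2)%N weq_cap_split_left cw.
    rewrite plugU /shift /= ?cats0 !addn0 !addn1; apply; try lia.
    have := mergeE i; rewrite /= => H.
    by have {}H := H ltac:(lia); congr (reducible _ _): H; lia.
  + have := @red_subst _ _ _ _ w i m (m - 1 + 2 - 1)%N weq_H_mirror cw.
    rewrite plugU /shift /= ?cats0 !addn0 !addn1; apply; try lia.
    have {}redH := redH i ltac:(lia).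
    by congr (reducible _ _): redH; lia.
Qed.

Lemma red_all n w : cod 0 w = Some n -> reducible n << w >>.
Proof.
elim/last_ind: w n => [|w [j g] IH] n; first by move=> [<-]; apply: red_word.
rewrite -cats1 cod_cat; case cw: (cod 0 w) => [m|] //=.
rewrite /slice_cod /=; case: leqP => //= jm [en].
have cs : slice_cod m (Slice j g) = Some n by rewrite /slice_cod /= jm en.
have [ug|dg] := boolP (upward (Slice j g)).
  by have := red_push ug cs (IH _ cw); rewrite plugU shift0.
suff redown x : reducible m x -> reducible n (plug [::] 0 [:: Slice j g] x).
  by have := redown _ (IH _ cw); rewrite plugU shift0.
elim=> [{cw IH}w uw cw|{}x sx|c {}x y _ rx _ ry].
- rewrite plugU shift0 /= -en; case: g dg jm {cs en} => //= _ jm.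
    by have [] := red_down uw cw jm; rewrite addn0.
  have [_] := red_down uw cw jm; congr reducible; lia.
- by apply: red_skein; apply: (@skein_plug _ _ _ _ _ _ _ 0 _ sx) => //=;
    rewrite ?add0n ?addn0 // cs.
- by rewrite linearP; apply: red_lin.
Qed.

(** Every upward piece has more outputs than inputs, so a word of the same width at both ends is
    empty. *)
Lemma cod_upward n m w : all upward w -> cod n w = Some m ->
  (n <= m)%N && ((m == n) ==> (w == [::])).
Proof.
elim: w n => [|[j g] w IH] n /=; first by move=> _ [->]; rewrite leqnn eqxx.
move=> /andP[ug uw]; rewrite /slice_cod /=; case: leqP => //= jn /(IH _ uw)/andP[le_m _].
have lt_g : (ins g < outs g)%N by case: g ug {jn le_m}.
by apply/andP; split; [lia|apply/implyP=> /eqP e; lia].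
Qed.

Lemma skein_scalar w : cod 0 w = Some 0 ->
  exists z : C, skein 0 0 (<< w >> - z *: << [::] >>).
Proof.
move=> /red_all; move: << w >> => x; elim=> [u uu cu|{}x sx|c {}x y _ [z1 h1] _ [z2 h2]].
- exists 1; have /andP[_ /implyP/(_ (eqxx _))/eqP->] := cod_upward uu cu.
  by rewrite scale1r subrr; apply: skein0.
- by exists 0; rewrite scale0r subr0.
- exists (c * z1 + z2); have := skein_lin c h1 h2.
  by rewrite scalerBr scalerDl opprD addrACA scalerA.
Qed.

Lemma skein_strand w : cod 0 w = Some 2 ->
  exists z : C, skein 0 2 (<< w >> - z *: << [:: Slice 0 Cup] >>).
Proof.
move=> /red_all; move: << w >> => x; elim=> [u uu cu|{}x sx|c {}x y _ [z1 h1] _ [z2 h2]].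
(* Starting from no string the first piece is a cup, and the width 2 is then reached, so that
   nothing follows. *)
- exists 1; suff -> : u = [:: Slice 0 Cup] by rewrite scale1r subrr; apply: skein0.
  case: u uu cu => [|[j g] u] //= /andP[ug uu].
  case: g ug => // _; rewrite /slice_cod /=; case: leqP => //= j0; last by lia.
  move=> /(cod_upward uu)/andP[_ /eqP->].
  by have -> : j = 0%N by lia.
- by exists 0; rewrite scale0r subr0.
- exists (c * z1 + z2); have := skein_lin c h1 h2.
  by rewrite scalerBr scalerDl opprD addrACA scalerA.
Qed.

End SkeinReduction.

(** * The state sum *)

Inductive weight := Low | Mid | Top.

Section StateSum.
Variables (F : fieldType) (Q r : F).
Implicit Types (G : seq weight -> F) (s : seq weight).

(* The cup, the cap and the two vertices as invariant maps of the
   three-dimensional representation of quantum SL(2), in a basis of weight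
   vectors.  The loop is [Q^-1 + 1 + Q], and the vertices are normalized by
   [r ^+ 2 * (1 + Q ^+ 2) = 1]. *)
Definition act_piece (g : piece) G s : F :=
  match g, s with
  | Cup, _ => Q^-1 * G [:: Low, Top & s] + G [:: Mid, Mid & s] + G [:: Top, Low & s]
  | Cap, [:: Low, Top & s'] => G s'
  | Cap, [:: Mid, Mid & s'] => G s'
  | Cap, [:: Top, Low & s'] => Q * G s'
  | Split, Low :: s' => r * G [:: Low, Mid & s'] - Q * r * G [:: Mid, Low & s']
  | Split, Mid :: s' => r * (G [:: Top, Low & s'] - G [:: Low, Top & s'])
                        + r * (1 - Q) * G [:: Mid, Mid & s']
  | Split, Top :: s' => r * G [:: Mid, Top & s'] - Q * r * G [:: Top, Mid & s']
  | Merge, [:: Low, Mid & s'] => r * G (Low :: s')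
  | Merge, [:: Mid, Low & s'] => - (Q * r) * G (Low :: s')
  | Merge, [:: Low, Top & s'] => - (Q * r) * G (Mid :: s')
  | Merge, [:: Mid, Mid & s'] => r * (1 - Q) * G (Mid :: s')
  | Merge, [:: Top, Low & s'] => Q * r * G (Mid :: s')
  | Merge, [:: Mid, Top & s'] => r * G (Top :: s')
  | Merge, [:: Top, Mid & s'] => - (Q * r) * G (Top :: s')
  | _, _ => 0
  end.

(* Read from the bottom, so that the matrix of [w] acts on functions of the
   labels of the top points. *)
Fixpoint act (w : word) G s : F :=
  if w is Slice i g :: w'
  then act_piece g (fun s' => act w' G (take i s ++ s')) (drop i s) else G s.

Definition linfun (T : Type) (L : (T -> F) -> F) :=
  forall c X Y, L (fun o => c * X o + Y o) = c * L X + L Y.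

Lemma linfun0 T (L : (T -> F) -> F) : linfun L -> L (fun=> 0) = 0.
Proof.
move=> linL; have := linL (-1) (fun=> 0) (fun=> 0).
by rewrite (_ : (fun _ => _) = fun=> 0) => [->|]; [ring | apply/funext => o; ring].
Qed.

Lemma linfunZ T (L : (T -> F) -> F) c X : linfun L -> L (fun o => c * X o) = c * L X.
Proof.
move=> linL; have := linL c X (fun=> 0); rewrite linfun0 // addr0 => <-.
by congr L; apply/funext => o; rewrite addr0.
Qed.

Lemma linfunD T (L : (T -> F) -> F) X Y :
  linfun L -> L (fun o => X o + Y o) = L X + L Y.
Proof.
move=> linL; have := linL 1 X Y; rewrite mul1r => <-.
by congr L; apply/funext => o; rewrite mul1r.
Qed.

Lemma linfunN T (L : (T -> F) -> F) X : linfun L -> L (fun o => - X o) = - L X.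
Proof.
move=> linL; rewrite -mulN1r -linfunZ //.
by congr L; apply/funext => o; rewrite mulN1r.
Qed.

Lemma act_piece_comm T g (K : seq weight -> T -> F) (L : (T -> F) -> F) s :
  linfun L -> act_piece g (fun s' => L (K s')) s = L (fun o => act_piece g (K^~ o) s).
Proof.
move=> linL.
by case: g s => [s|[|[] [|[] s]]|[|[] s]|[|[] [|[] s]]] //=;
  rewrite ?linfun0 // ?(linfunD _ _ linL) ?(linfunN _ linL) ?(linfunZ _ _ linL)
          ?(linfunD _ _ linL) ?(linfunN _ linL) ?(linfunZ _ _ linL).
Qed.

(** For fixed labels [act w] is a finite linear combination of values, so it commutes with a linear
    functional in a second variable. With [L] another diagram, this says that diagrams side by side
    do not interact. *)
Lemma act_comm T w (K : seq weight -> T -> F) (L : (T -> F) -> F) s :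
  linfun L -> act w (fun s' => L (K s')) s = L (fun o => act w (K^~ o) s).
Proof.
move=> linL; elim: w s => [|[i g] w IHw] s //=.
rewrite -act_piece_comm //; congr act_piece; apply/funext => s'.
exact: IHw.
Qed.

Lemma act_piece_lin g s : linfun (act_piece g ^~ s).
Proof.
move=> c X Y.
by case: g s => [s|[|[] [|[] s]]|[|[] s]|[|[] [|[] s]]] //=; ring.
Qed.

Lemma act_lin w s : linfun (act w ^~ s).
Proof.
elim: w s => [|[i g] w IHw] s c X Y //=; rewrite -act_piece_lin.
by congr act_piece; apply/funext => s'; rewrite IHw.
Qed.

Lemma act_cat u v G : act (u ++ v) G = act u (act v G).
Proof.
elim: u => [|[i g] u IHu] //=; apply/funext => s.
by rewrite IHu.
Qed.

Lemma act_shift i w G s1 s2 : size s1 = i ->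
  act (shift i w) G (s1 ++ s2) = act w (fun s => G (s1 ++ s)) s2.
Proof.
move=> sz; elim: w s2 => [|[j g] w IHw] s2 //=.
rewrite take_cat drop_cat sz ltnNge leq_addr /= addKn.
by congr act_piece; apply/funext => s; rewrite -catA IHw.
Qed.

Lemma act_piece_local g G s t : (ins g <= size s)%N ->
  act_piece g G (s ++ t) = act_piece g (fun o => G (o ++ t)) s.
Proof. by case: g s => [s|[|[] [|[] s]]|[|[] s]|[|[] [|[] s]]]. Qed.

Lemma act_piece_eq_size g G G' s : (ins g <= size s)%N ->
  (forall o, size o = (size s - ins g + outs g)%N -> G o = G' o) ->
  act_piece g G s = act_piece g G' s.
Proof.
by case: g s => [s|[|[] [|[] s]]|[|[] s]|[|[] [|[] s]]] //= _ GE; rewrite ?GE //=; lia.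
Qed.

(** Test functions matter only on label lists of the right width. This excludes lists that are too
    short, on which [act_piece] may take its default value 0. *)
Lemma act_eq_size w m G G' s : cod (size s) w = Some m ->
  (forall o, size o = m -> G o = G' o) -> act w G s = act w G' s.
Proof.
elim: w s => [|[i g] w IHw] s /=; first by move=> [<-]; apply.
rewrite /slice_cod /=; case: leqP => //= le_s cw GE.
apply: act_piece_eq_size => [|o]; first by rewrite size_drop; lia.
rewrite size_drop => szo; apply: IHw GE; rewrite -cw size_cat size_takel; last by lia.
by congr cod; lia.
Qed.

Lemma act_local w m G s t : cod (size s) w = Some m ->
  act w G (s ++ t) = act w (fun o => G (o ++ t)) s.
Proof.
elim: w s => [|[i g] w IHw] s //=; rewrite /slice_cod /=; case: leqP => //= le_s cw.
have -> : take i (s ++ t) = take i s by rewrite takel_cat //; lia.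
have -> : drop i (s ++ t) = drop i s ++ t.
  rewrite drop_cat; case: ltngtP => // [|->]; first by lia.
  by rewrite subnn drop0 drop_size.
rewrite act_piece_local ?size_drop; last by lia.
apply: act_piece_eq_size => [|o]; first by rewrite size_drop; lia.
rewrite size_drop => szo; rewrite catA; apply: IHw; rewrite -cw size_cat size_takel; last by lia.
by congr cod; lia.
Qed.

Lemma act_exchange u v m G s t : cod (size s) u = Some m ->
  act (u ++ shift m v) G (s ++ t) = act (shift (size s) v ++ u) G (s ++ t).
Proof.
move=> cu; rewrite !act_cat act_shift // (act_local _ _ cu).
under [in RHS]eq_fun do rewrite (act_local _ _ cu).
rewrite -(act_comm u (fun o o' => G (o ++ o')) s (act_lin v t)).
by apply: (act_eq_size cu) => o /act_shift.
Qed.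

Lemma mirror_cat u v : mirror (u ++ v) = mirror v ++ mirror u.
Proof. by rewrite /mirror map_cat rev_cat. Qed.

Lemma mirror_shift i u : mirror (shift i u) = shift i (mirror u).
Proof. by rewrite /mirror /shift map_rev -!map_comp. Qed.

Lemma mirrorK : involutive mirror.
Proof.
move=> u; rewrite /mirror map_rev revK -map_comp -[RHS]map_id.
by apply: eq_map => -[i []].
Qed.

Hypotheses (Q0 : Q != 0) (rQ : r ^+ 2 * Q ^+ 2 = 1 - r ^+ 2).
Let QV : Q^-1 * Q = 1. Proof. exact: mulVf. Qed.

Lemma act_rel_exchange g k h G s : (ins g <= size s)%N ->
  act [:: Slice 0 g; Slice (outs g + k) h] G s =
  act [:: Slice (ins g + k) h; Slice 0 g] G s.
Proof.
move=> le_s; rewrite -(cat_take_drop (ins g) s).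
have szt : size (take (ins g) s) = ins g by rewrite size_takel.
have := @act_exchange [:: Slice 0 g] [:: Slice k h] (outs g) G (take (ins g) s) (drop (ins g) s).
by rewrite szt; apply; rewrite /cod /slice_cod /= add0n leqnn subnn.
Qed.

Lemma act_zigzag_left G s : (0 < size s)%N ->
  act [:: Slice 1 Cup; Slice 0 Cap] G s = G s.
Proof. by case: s => [|[] s] //= _; rewrite ?take0 ?drop0 /=; ring: QV. Qed.

Lemma act_zigzag_right G s : (0 < size s)%N ->
  act [:: Slice 0 Cup; Slice 1 Cap] G s = G s.
Proof. by case: s => [|[] s] //= _; rewrite ?take0 ?drop0 /=; ring: QV. Qed.

Lemma act_bend_left G s : (0 < size s)%N ->
  act [:: Slice 0 Cup; Slice 1 Merge] G s = act [:: Slice 0 Split] G s.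
Proof. by case: s => [|[] s] //= _; rewrite ?take0 ?drop0 /=; ring: QV. Qed.

Lemma act_bend_right G s : (0 < size s)%N ->
  act [:: Slice 1 Cup; Slice 0 Merge] G s = act [:: Slice 0 Split] G s.
Proof. by case: s => [|[] s] //= _; rewrite ?take0 ?drop0 /=; ring: QV. Qed.

Lemma act_cobend_left G s : (1 < size s)%N ->
  act [:: Slice 1 Split; Slice 0 Cap] G s = act [:: Slice 0 Merge] G s.
Proof. by case: s => [|[] [|[] s]] //= _; rewrite ?take0 ?drop0 /=; ring: QV. Qed.

Lemma act_cobend_right G s : (1 < size s)%N ->
  act [:: Slice 0 Split; Slice 1 Cap] G s = act [:: Slice 0 Merge] G s.
Proof. by case: s => [|[] [|[] s]] //= _; rewrite ?take0 ?drop0 /=; ring: QV. Qed.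

Lemma act_loop G s :
  act [:: Slice 0 Cup; Slice 0 Cap] G s = (Q^-1 + 1 + Q) * G s.
Proof. by rewrite /= ?take0 ?drop0 /=; ring: QV. Qed.

Lemma act_lollipop G s : (0 < size s)%N ->
  act [:: Slice 0 Split; Slice 0 Cap] G s = 0.
Proof. by case: s => [|[] s] //= _; rewrite ?take0 ?drop0 /=; ring: QV. Qed.

Lemma act_colollipop G s : act [:: Slice 0 Cup; Slice 0 Merge] G s = 0.
Proof. by rewrite /= ?take0 ?drop0 /=; ring: QV. Qed.

Lemma act_bigon G s : (0 < size s)%N ->
  act [:: Slice 0 Split; Slice 0 Merge] G s = G s.
Proof. by case: s => [|[] s] //= _; rewrite ?take0 ?drop0 /=; ring: QV rQ. Qed.

Lemma act_triangle G s : (0 < size s)%N ->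
  act [:: Slice 0 Split; Slice 0 Split; Slice 1 Merge] G s =
  (1 - Q * r ^+ 2) * act [:: Slice 0 Split] G s.
Proof. by case: s => [|[] s] //= _; rewrite ?take0 ?drop0 /=; ring: QV rQ. Qed.

Lemma act_cotriangle G s : (1 < size s)%N ->
  act [:: Slice 1 Split; Slice 0 Merge; Slice 0 Merge] G s =
  (1 - Q * r ^+ 2) * act [:: Slice 0 Merge] G s.
Proof. by case: s => [|[] [|[] s]] //= _; rewrite ?take0 ?drop0 /=; ring: QV rQ. Qed.

Lemma act_I_H G s : (1 < size s)%N ->
  act [:: Slice 0 Merge; Slice 0 Split] G s - act [:: Slice 0 Split; Slice 1 Merge] G s
  = Q * r ^+ 2 * (G s - act [:: Slice 0 Cap; Slice 0 Cup] G s).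
Proof. by case: s => [|[] [|[] s]] //= _; rewrite ?take0 ?drop0 /=; ring: QV rQ. Qed.

Lemma act_I_coH G s : (1 < size s)%N ->
  act [:: Slice 0 Merge; Slice 0 Split] G s - act [:: Slice 1 Split; Slice 0 Merge] G s
  = Q * r ^+ 2 * (G s - act [:: Slice 0 Cap; Slice 0 Cup] G s).
Proof. by case: s => [|[] [|[] s]] //= _; rewrite ?take0 ?drop0 /=; ring: QV rQ. Qed.

End StateSum.

(** The weights are rational expressions in [Q] and [r] with integer coefficients, so a field
    morphism acts on the state sum through these two parameters. It is applied to complex
    conjugation. *)
Lemma act_conj (F F' : fieldType) (f : {rmorphism F -> F'}) Q r w G s :
  f (act Q r w G s) = act (f Q) (f r) w (f \o G) s.
Proof.
have piece g H t : f (act_piece Q r g H t) = act_piece (f Q) (f r) g (f \o H) t.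
  case: g t => [t|[|[] [|[] t]]|[|[] t]|[|[] [|[] t]]] //=;
  by rewrite ?(rmorph0, rmorphD, rmorphB, rmorphN, rmorphM, fmorphV, rmorph1).
elim: w s => [|[i g] w IHw] s //=; rewrite piece.
by congr act_piece; apply/funext => s' /=; rewrite IHw.
Qed.

Local Arguments act : simpl never.

(** * Evaluation of closed diagrams by the state sum *)

Section Evaluation.
Variables (R : realType) (d : R) (Q r : R[i]).
Local Notation C := R[i].
Local Notation FW := {freeg word / C}.
Local Notation skein := (@skein R d).
Local Notation relator := (@relator R d).
Local Notation act := (@act C Q r).
Hypotheses (Q0 : Q != 0) (Qd : Q ^+ 2 + 1 = (d%:C%C - 1) * Q)
  (rQ : r ^+ 2 * Q ^+ 2 = 1 - r ^+ 2).

Let d1 : d%:C%C - 1 != 0 :> C.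
Proof.
apply/eqP => d0; have := Qd; rewrite d0 mul0r => Q1.
have /eqP : r ^+ 2 * (Q ^+ 2 + 1) = 1 by rewrite mulrDr rQ mulr1 subrK.
by rewrite Q1 mulr0 eq_sym oner_eq0.
Qed.

(** By [Qd], (d - 1) Q r^2 = (Q^2 + 1) r^2, which is 1 by [rQ]; hence the coefficient found in
    [act_I_H] is the one of the skein relation. *)
Let dV : ((d - 1)^-1)%:C%C = Q * r ^+ 2 :> C.
Proof.
rewrite fmorphV rmorphB rmorph1; apply: (mulfI d1); rewrite divff // mulrA -Qd.
by rewrite mulrDl mul1r mulrC rQ subrK.
Qed.

Let d_triangle : ((d - 2) / (d - 1))%:C%C = 1 - Q * r ^+ 2 :> C.
Proof.
have d1R : d - 1 != 0.
  by apply: contra_neq d1 => d0; rewrite -(rmorph1 (real_complex R)) -rmorphB d0.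
have -> : (d - 2) / (d - 1) = 1 - (d - 1)^-1 by field.
by rewrite rmorphB rmorph1 -dV.
Qed.

Let loopE : Q^-1 + 1 + Q = d%:C%C.
Proof.
apply: (mulIf Q0); rewrite !mulrDl mulVf // mul1r -expr2 addrAC [1 + _]addrC Qd.
by rewrite mulrBl mul1r subrK.
Qed.

Lemma fglift_act_comm w (f : word -> word) G s (x : FW) :
  fglift (fun u => act (w ++ f u) G s : C^o) x =
  act w (fun s' => fglift (fun u => act (f u) G s' : C^o) x) s.
Proof.
pose L (X : word -> C) := \sum_(u <- dom x) coeff u x * X u.
have linL : linfun L.
  move=> c X Y; rewrite /L mulr_sumr -big_split; apply: eq_bigr => u _ /=.
  by rewrite mulrDr mulrCA.
have -> : (fun s' => fglift (fun u => act (f u) G s' : C^o) x) =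
    fun s' => L (fun u => act (f u) G s').
  by apply/funext => s'; apply: fglift_sum.
rewrite fglift_sum (act_comm Q r w (fun s' u => act (f u) G s') s linL).
by apply: eq_bigr => u _; rewrite act_cat.
Qed.

Lemma act_relator m n x G s : relator m n x -> (m <= size s)%N ->
  fglift (fun u => act u G s : C^o) x = 0.
Proof.
case=> [g k h|||||||||] le_s; rewrite ?linearB ?linearZ ?linearB /= ?fgliftU ?/GRing.scale /=.
- by rewrite act_rel_exchange ?subrr //; apply: leq_trans le_s; rewrite -addnA leq_addr.
- by rewrite act_zigzag_left ?subrr.
- by rewrite act_zigzag_right ?subrr.
- by rewrite act_bend_left ?subrr.
- by rewrite act_bend_right ?subrr.
- by rewrite act_loop // loopE mulrN subrr.
- by rewrite act_lollipop.
- by rewrite act_bigon ?subrr.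
- by rewrite act_triangle // d_triangle mulrN subrr.
- have /eqP := act_I_H Q0 rQ G le_s; rewrite -subr_eq0 => /eqP <-.
  by rewrite dV -[act [::] G s]/(G s); ring.
Qed.

(** This makes the evaluation invariant under reflection, on which the Hermitian symmetry of the
    gluing form rests. *)
Lemma act_relator_mirror m n x G s : relator m n x -> (n <= size s)%N ->
  fglift (fun u => act (mirror u) G s : C^o) x = 0.
Proof.
case=> [g k h|||||||||] le_s; rewrite ?linearB ?linearZ ?linearB /= ?fgliftU;
  rewrite /mirror /= ?/GRing.scale /=.
- have ioE : ins (flip g) = outs g /\ outs (flip g) = ins g by case: (g).
  rewrite -ioE.1 -ioE.2.
  have := @act_rel_exchange C Q r (flip g) k (flip h) G s.
  move=> -> //; first by rewrite subrr.
  by rewrite ioE.1; apply: leq_trans le_s; rewrite -addnA leq_addr.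
- by rewrite act_zigzag_right ?subrr.
- by rewrite act_zigzag_left ?subrr.
- by rewrite act_cobend_left ?subrr.
- by rewrite act_cobend_right ?subrr.
- by rewrite act_loop // loopE mulrN subrr.
- by rewrite act_colollipop.
- by rewrite act_bigon ?subrr.
- by rewrite act_cotriangle // d_triangle mulrN subrr.
- have /eqP := act_I_coH Q0 rQ G le_s; rewrite -subr_eq0 => /eqP <-.
  by rewrite dV -[act [::] G s]/(G s); ring.
Qed.

(** The map [f] is the identity or [mirror], so that one argument serves for the relations and for
    their reflections. *)
Lemma act_plug_eq0 m (f : word -> word) p i j q G s (x : FW) :
  (forall G s, (m <= size s)%N -> fglift (fun u => act (f u) G s : C^o) x = 0) ->
  cod (size s) p = Some (i + m + j)%N ->
  fglift (fun u => act (p ++ shift i (f u) ++ q) G s : C^o) x = 0.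
Proof.
move=> fx cp; rewrite fglift_act_comm -[RHS](linfun0 (act_lin Q r p s)).
apply: (@act_eq_size C Q r p (i + m + j)%N _ _ s cp) => o szo.
rewrite -(fx (fun s' => act q G (take i o ++ s')) (drop i o)).
  congr fglift; apply/funext => u; rewrite act_cat -{1}(cat_take_drop i o).
  by rewrite act_shift // size_takel // szo; lia.
by rewrite size_drop szo; lia.
Qed.

Lemma act_skein a b x G s : skein a b x -> size s = a ->
  fglift (fun u => act u G s : C^o) x = 0.
Proof.
move=> sx sz; elim: {x} sx.
- move=> m n x p i j q rx cp cq; rewrite /plug fglift_comp.
  apply: (@act_plug_eq0 m id _ _ j); last by rewrite sz.
  by move=> G' s'; apply: act_relator rx.
- exact: linear0.
- by move=> c x y _ hx _ hy; rewrite linearP /= hx hy scaler0 addr0.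
Qed.

Lemma act_skein_mirror a b x G s : skein a b x -> size s = b ->
  fglift (fun u => act (mirror u) G s : C^o) x = 0.
Proof.
move=> sx sz; elim: {x} sx.
- move=> m n x p i j q rx cp cq; rewrite /plug fglift_comp.
  rewrite -[RHS](@act_plug_eq0 n mirror (mirror q) i j (mirror p) G s x).
  + congr fglift; apply/funext => u /=.
    by rewrite !mirror_cat mirror_shift -catA.
  + by move=> G' s'; apply: act_relator_mirror rx.
  + by rewrite sz (cod_mirror cq).
- exact: linear0.
- by move=> c x y _ hx _ hy; rewrite linearP /= hx hy scaler0 addr0.
Qed.

Definition stateZ (w : word) : C := act w (fun=> 1) [::].

Lemma stateZ_loop : stateZ [:: Slice 0 Cup; Slice 0 Cap] = d%:C%C.
Proof. by rewrite /stateZ act_loop // loopE mulr1. Qed.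

(** The state sum respects the relations and is 1 on the empty diagram, so it determines [z]; hence
    the scalar chosen by [evaluation] is unique. *)
Lemma evaluation_scalar (w : diagram 0 0) z :
  skein 0 0 (<< val w >> - z *: << [::] >>) ->
  [/\ evaluation d w = z, stateZ (val w) = z & stateZ (mirror (val w)) = z].
Proof.
have stateE z' : skein 0 0 (<< val w >> - z' *: << [::] >>) -> stateZ (val w) = z'.
  move=> sz; have := act_skein (fun=> 1) sz (erefl (size [::])).
  by rewrite linearB linearZ /= !fgliftU => /subr0_eq e; rewrite /stateZ e /GRing.scale /= mulr1.
move=> sz; split; last 2 first.
- exact: stateE.
- have := act_skein_mirror (fun=> 1) sz (erefl (size [::])).
  by rewrite linearB linearZ /= !fgliftU => /subr0_eq e; rewrite /stateZ e /GRing.scale /= mulr1.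
- by rewrite /evaluation; case: xgetP => [y _ /stateE <-|/(_ z)] //; apply: stateE.
Qed.

Lemma evaluationE (w : diagram 0 0) : evaluation d w = stateZ (val w).
Proof. by have [z /evaluation_scalar[-> ->]] := skein_scalar d (eqP (valP w)). Qed.

Lemma stateZ_mirror w : cod 0 w = Some 0 -> stateZ (mirror w) = stateZ w.
Proof.
move=> /eqP cw; have [z sz] := skein_scalar d (eqP cw).
by have [_ /= -> ->] := @evaluation_scalar (mk_diagram cw) z sz.
Qed.

(** The form in which the bound on C_2 is used: it holds for every test function, hence for every
    continuation of the diagram upward. *)
Lemma act_strand w : cod 0 w = Some 2 ->
  exists z : C, forall G, act w G [::] = z * act [:: Slice 0 Cup] G [::].
Proof.
move=> /(skein_strand d)[z sz]; exists z => G.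
have := act_skein G sz (erefl (size [::])).
by rewrite linearB linearZ /= !fgliftU => /subr0_eq->.
Qed.

End Evaluation.

(** [Q] is a root of Q^2 - (d - 1) Q + 1, taken among the complex numbers because the discriminant
    is negative for d < 3. [r] is a square root of 1 / (Q^2 + 1), and d > 1 keeps Q^2 + 1 = (d - 1)
    Q away from 0. *)
Lemma quantum_parameter (R : realType) (d : R) : 1 < d -> exists Q r : R[i],
  [/\ Q != 0, Q ^+ 2 + 1 = (d%:C%C - 1) * Q & r ^+ 2 * Q ^+ 2 = 1 - r ^+ 2].
Proof.
move=> d1; pose e : R[i] := d%:C%C - 1.
pose D : R[i] := sqrtC (e ^+ 2 - 4).
have DE : D ^+ 2 = e ^+ 2 - 4 by exact: sqrtCK.
pose Q := (e + D) / 2.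
have QE : Q ^+ 2 + 1 = e * Q.
  by rewrite /Q; field: DE.
have e0 : e != 0.
  rewrite /e -(rmorph1 (real_complex R)) -rmorphB fmorph_eq0 subr_eq0.
  by apply: contraTneq d1 => ->; rewrite ltxx.
have Q0 : Q != 0.
  by apply: contra_eqN QE => /eqP->; rewrite expr0n mulr0 add0r oner_eq0.
have Q1 : Q ^+ 2 + 1 != 0 by rewrite QE mulf_neq0.
exists Q, (sqrtC (Q ^+ 2 + 1)^-1); split=> //.
rewrite sqrtCK; apply: (mulIf Q1); rewrite mulrBl !mul1r mulVf //.
by rewrite mulrAC mulVf // mul1r addrK.
Qed.

(** The conjugates of [Q] and [r] satisfy the same equations, and the evaluation does not depend on
    the chosen solution. *)
Lemma evaluation_conj (R : realType) (d : R) (w : diagram 0 0) : 1 < d ->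
  (evaluation d w)^* = evaluation d w.
Proof.
move=> /quantum_parameter[Q [r [Q0 Qd rQ]]].
have Qd' : Q^* ^+ 2 + 1 = (d%:C%C - 1) * Q^*.
  have := congr1 (@Num.conj R[i]) Qd.
  rewrite rmorphD rmorphXn rmorph1 rmorphM rmorphB rmorph1 => ->; congr ((_ - 1) * _).
  by apply: conj_Creal; apply/complex_realP; exists d.
have rQ' : r^* ^+ 2 * Q^* ^+ 2 = 1 - r^* ^+ 2.
  by have := congr1 (@Num.conj R[i]) rQ; rewrite rmorphB rmorph1 rmorphM !rmorphXn.
have Q0' : Q^* != 0 by rewrite conjC_eq0.
rewrite [in RHS](evaluationE Q0' Qd' rQ') (evaluationE Q0 Qd rQ) /stateZ act_conj.
by congr act; apply/funext => s /=; rewrite rmorph1.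
Qed.

(** * The spaces of diagrams *)

Section Pairing.
Variables (R : realType) (d : R).
Hypothesis d_gt1 : 1 < d.
Local Notation C := R[i].
Local Notation FD k := {freeg (diagram 0 k) / C}.
Local Notation gluing_form := (@gluing_form R d _).
Local Notation cls := (@cls R d _).

Lemma gluing_formU k (u v : diagram 0 k) :
  gluing_form << u >> << v >> = evaluation d (compose (adjoint v) u).
Proof. by rewrite /Defs.gluing_form !domU1 !big_seq1 !coeffU !eqxx !mulr1 conjC1 mulr1 mul1r. Qed.

Lemma gluing_form_suml k (x y : FD k) :
  gluing_form x y = \sum_(u <- dom x) coeff u x * gluing_form << u >> y.
Proof.
rewrite [in LHS]/Defs.gluing_form; apply: eq_bigr => u _.
rewrite /Defs.gluing_form domU1 big_seq1 coeffU eqxx mulr1 mulr_sumr.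
by apply: eq_bigr => v _; rewrite mul1r mulrA.
Qed.

Lemma evaluation_adjoint (w : diagram 0 0) :
  evaluation d (adjoint w) = evaluation d w.
Proof.
have [Q [r [Q0 Qd rQ]]] := quantum_parameter d_gt1.
by rewrite !(evaluationE Q0 Qd rQ) (stateZ_mirror Q0 Qd rQ) // (eqP (valP w)).
Qed.

(** Reflecting the closed diagram exchanges its two glued halves, and the evaluation is real and
    invariant under reflection. *)
Lemma gluing_form_conj k (x y : FD k) : gluing_form y x = (gluing_form x y)^*.
Proof.
rewrite /Defs.gluing_form exchange_big rmorph_sum; apply: eq_bigr => u _.
rewrite rmorph_sum; apply: eq_bigr => v _ /=.
rewrite !rmorphM /= conjCK (evaluation_conj _ d_gt1).
congr (_ * _); first exact: mulrC.
rewrite -evaluation_adjoint; congr evaluation; apply: val_inj.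
by rewrite /= mirror_cat mirrorK.
Qed.

(** The radical is defined by the first argument; Hermitian symmetry gives independence of the
    representative in the second. *)
Lemma pairing_cls k (x y : FD k) : pairing (cls x) (cls y) = gluing_form x y.
Proof.
have reprP (z : FD k) w : gluing_form (repr (cls z)) w = gluing_form z w.
  apply/eqP; rewrite -subr_eq0 -(mulN1r (gluing_form z w)) addrC -gluing_form_lin.
  rewrite scaleN1r addrC; apply/eqP.
  have : cls (repr (cls z)) == cls z by rewrite reprK_cls.
  by rewrite clsE => /asboolP.
by rewrite /pairing reprP gluing_form_conj reprP -gluing_form_conj.
Qed.

Lemma gluing_form_map m k (h : diagram 0 m -> diagram 0 k) (x : FD m) y :
  gluing_form (fglift (fun u => << h u >> : FD k) x) y =
  \sum_(u <- dom x) coeff u x * gluing_form << h u >> y.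
Proof.
pose G u := gluing_form << u >> y.
transitivity (fglift (G : _ -> C^o) (fglift (fun u => << h u >> : FD k) x)).
  by rewrite gluing_form_suml fglift_sum.
by rewrite fglift_comp fglift_sum.
Qed.

Lemma gluing_form_map2 m n k (h : diagram 0 m -> diagram 0 k)
    (h' : diagram 0 n -> diagram 0 k) (x : FD m) (y : FD n) :
  gluing_form (fglift (fun u => << h u >> : FD k) x)
              (fglift (fun v => << h' v >> : FD k) y) =
  \sum_(u <- dom x) \sum_(v <- dom y)
    coeff u x * (coeff v y)^* * evaluation d (compose (adjoint (h' v)) (h u)).
Proof.
rewrite gluing_form_map; apply: eq_bigr => u _.
rewrite gluing_form_conj gluing_form_map rmorph_sum mulr_sumr.
by apply: eq_bigr => v _; rewrite rmorphM /= -gluing_form_conj gluing_formU mulrA.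
Qed.

Lemma fglift_id (K : choiceType) (x : {freeg K / C}) :
  fglift (fun u => << u >> : {freeg K / C}) x = x.
Proof. exact/esym/(fglift_unique idfun x). Qed.

(** Composition with [g] has an adjoint for the form, composition with the reflection of [g]; so it
    preserves negligible combinations, and the choice of a representative is immaterial. *)
Lemma Cspace_map_cls m n (g : diagram m n) (x : FD m) :
  Cspace_map (compose g) (cls x) = cls (fglift (fun u => << compose g u >> : FD n) x).
Proof.
apply/eqP; rewrite /Cspace_map clsE -linearB /=.
have : cls (repr (cls x)) == cls x by rewrite reprK_cls.
rewrite clsE => /asboolP zN; apply/asboolP => y; rewrite -[y]fglift_id.
rewrite gluing_form_map2.
have := zN (fglift (fun v => << compose (adjoint g) v >> : FD m) y).
set z := _ - x; rewrite -{1}[z]fglift_id gluing_form_map2 => z0; rewrite -[RHS]z0.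
apply: eq_bigr => u _; apply: eq_bigr => v _; congr (_ * _); congr evaluation.
by apply: val_inj; rewrite /= mirror_cat mirrorK -catA.
Qed.

(** In the pairing with a diagram [w], only the action of [u] on the function given by the
    reflection of [w] appears. *)
Lemma eq_cls_of_act (Q r : C) k (u v : diagram 0 k) :
  Q != 0 -> Q ^+ 2 + 1 = (d%:C%C - 1) * Q -> r ^+ 2 * Q ^+ 2 = 1 - r ^+ 2 ->
  (forall G, act Q r (val u) G [::] = act Q r (val v) G [::]) ->
  cls << u >> = cls << v >>.
Proof.
move=> Q0 Qd rQ uv.
apply/eqP; rewrite clsE; apply/asboolP => y.
rewrite addrC -scaleN1r gluing_form_lin mulN1r addrC; apply/eqP; rewrite subr_eq0.
apply/eqP; rewrite gluing_form_conj [RHS]gluing_form_conj; congr (_^*).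
rewrite gluing_form_suml [RHS]gluing_form_suml; apply: eq_bigr => w _.
rewrite gluing_form_conj [gluing_form _ << v >>]gluing_form_conj !gluing_formU.
by rewrite !(evaluationE Q0 Qd rQ) /stateZ /= !act_cat uv.
Qed.

End Pairing.

(** * Trees *)

Lemma btree_word_shift i j t : btree_word (i + j) t = shift i (btree_word j t).
Proof.
elim: t i j => [|l IHl r IHr] i j //=.
by rewrite shift_cat -addnS IHl IHr.
Qed.

Definition cup_word t u := Slice 0 Cup :: btree_word 1 u ++ btree_word 0 t.

Lemma cod_cup_word t u : cod 0 (cup_word t u) = Some (leaves t + leaves u)%N.
Proof.
rewrite /cup_word /= cod_cat cod_btree_word //= cod_btree_word //.
by congr Some; have := leaves_gt0 t; lia.
Qed.

Section TreeWords.
Variables (F : fieldType) (Q r : F).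
Hypothesis Q0 : Q != 0.
Local Notation act := (@act F Q r).
Implicit Types (G : seq weight -> F) (t u : btree).

Lemma act_cup_split G s :
  act [:: Slice 0 Cup; Slice 0 Split] G s = act [:: Slice 0 Cup; Slice 1 Split] G s.
Proof.
have QV : Q^-1 * Q = 1 by exact: mulVf.
by rewrite /act /= ?take0 ?drop0 /=; ring: QV.
Qed.

(* The string joining the roots of two trees slides through a branching: the
   diagram only depends on the planar tree obtained by forgetting the root. *)
Lemma act_cup_word_rot t1 t2 u G :
  act (cup_word (Node t1 t2) u) G [::] = act (cup_word t1 (Node t2 u)) G [::].
Proof.
set w := btree_word 1 t2 ++ btree_word 0 t1.
have -> : cup_word (Node t1 t2) u =
    [:: Slice 0 Cup] ++ (shift 1 (btree_word 0 u) ++ [:: Slice 0 Split]) ++ w.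
  by rewrite -btree_word_shift /cup_word /= -catA.
have -> : cup_word t1 (Node t2 u) =
    [:: Slice 0 Cup; Slice 1 Split] ++ shift 2 (btree_word 0 u) ++ w.
  by rewrite -btree_word_shift /cup_word /= -catA.
transitivity (act ([:: Slice 0 Cup; Slice 0 Split] ++ shift 2 (btree_word 0 u) ++ w) G [::]).
  rewrite -[RHS]/(act ([:: Slice 0 Cup] ++ ([:: Slice 0 Split] ++
    shift 2 (btree_word 0 u) ++ w)) G [::]) act_cat [in RHS]act_cat.
  apply: (@act_eq_size _ _ _ _ 2) => // -[|a [|b []]] // _.
  rewrite catA act_cat [in RHS]act_cat.
  exact/esym/(@act_exchange _ Q r [:: Slice 0 Split] (btree_word 0 u) 2 _ [:: a] [:: b]).
by rewrite act_cat [in RHS]act_cat act_cup_split.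
Qed.

(** Repeated use of [act_cup_word_rot] strips [t] down to its first leaf: this is the planar tree
    seen from that leaf. *)
Lemma act_cup_word_leafl t u : exists u', [/\ (leaves u').+1 = (leaves t + leaves u)%N &
  forall G, act (cup_word t u) G [::] = act (cup_word Leaf u') G [::]].
Proof.
elim: t u => [|t1 IH1 t2 _] u; first by exists u.
have [u' [szu' eu']] := IH1 (Node t2 u); exists u'; split; first by rewrite szu' /= addnA.
by move=> G; rewrite act_cup_word_rot eu'.
Qed.

Lemma act_cup_word_leafr t u : exists t', [/\ (leaves t').+1 = (leaves t + leaves u)%N &
  forall G, act (cup_word t u) G [::] = act (cup_word t' Leaf) G [::]].
Proof.
elim: u t => [|u1 IH1 u2 IH2] t; first by exists t; rewrite addn1.
have [t' [szt' et']] := IH2 (Node t u1); exists t'; split; first by rewrite szt' /= addnA.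
by move=> G; rewrite -act_cup_word_rot et'.
Qed.

End TreeWords.

Lemma forest_word_leaves i k f : forest_word i (nseq k Leaf ++ f) = forest_word (i + k) f.
Proof.
elim: k i => [|k IHk] i /=; first by rewrite addn0.
by rewrite cats0 IHk addSnnS.
Qed.

Lemma forest_word_leaves0 i k : forest_word i (nseq k Leaf) = [::].
Proof. by rewrite -[nseq k Leaf]cats0 forest_word_leaves. Qed.

Lemma sumn_leaves k : sumn (map leaves (nseq k Leaf)) = k.
Proof. by rewrite map_nseq sumn_nseq mul1n. Qed.

Definition mk_forest m n (f : seq btree)
    (fP : (size f == m) && (sumn (map leaves f) == n)) : forest m n :=
  exist (fun f => is_true ((size f == m) && (sumn (map leaves f) == n))) f fP.

(** * Contraction of a pairing to vacuum coefficients *)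

Section Contraction.
Variables (R : realType) (d : R).
Hypothesis d_gt1 : 1 < d.
Local Notation C := R[i].
Local Notation cls := (@cls R d _).

Fact forest2_subproof t u :
  (size [:: t; u] == 2%N) && (sumn (map leaves [:: t; u]) == (leaves t + leaves u)%N).
Proof. by rewrite /= addn0 eqxx. Qed.

Definition forest2 t u : forest 2 (leaves t + leaves u) := 
  mk_forest (forest2_subproof t u).

(* The vector of the tree [Node t u] that represents a multiple of the vacuum. *)
Definition cup_vector t u : Cspace d (leaves t + leaves u) :=
  forest_map (forest2 t u) (cls << strand >>).

Definition cup_diagram t u : diagram 0 (leaves t + leaves u) :=
  mk_diagram (introT eqP (cod_cup_word t u)).

Lemma cup_vectorE t u : cup_vector t u = cls << cup_diagram t u >>.
Proof.
rewrite /cup_vector /forest_map (Cspace_map_cls d_gt1) fgliftU.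
by congr (Defs.cls _ << _ >>); apply: val_inj.
Qed.

(** The reflected [t'] joins all strings of [x] but the first into one, which leaves a diagram with
    two ends, acting as [z] times a cup. Closing it by a cap gives [z] times the loop [d], whence
    the factor 1/d; continuing it by [t] and the reflected [y] gives [z] times the last factor. *)
Lemma stateZ_contract (Q r : C) (x y : word) k t t' :
  Q != 0 -> Q ^+ 2 + 1 = (d%:C%C - 1) * Q -> r ^+ 2 * Q ^+ 2 = 1 - r ^+ 2 ->
  cod 0 x = Some k.+1 -> leaves t = k -> leaves t' = k ->
  stateZ Q r (x ++ btree_word 0 t ++ mirror (y ++ btree_word k t')) =
  d%:C%C^-1 * stateZ Q r (x ++ mirror (cup_word Leaf t'))
            * stateZ Q r (cup_word t Leaf ++ mirror y).
Proof.
move=> Q0 Qd rQ cx tk t'k; set V := mirror (btree_word 0 t').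
have cV : cod k V = Some 1%N.
  by apply: cod_mirror; rewrite cod_btree_word //= t'k.
have ct : cod 1 (btree_word 0 t) = Some k by rewrite cod_btree_word //= tk.
have -> : mirror (y ++ btree_word k t') = shift k V ++ mirror y.
  by rewrite -mirror_shift -btree_word_shift addn0 mirror_cat.
have -> : mirror (cup_word Leaf t') = shift 1 V ++ [:: Slice 0 Cap].
  by rewrite -mirror_shift -btree_word_shift /cup_word /= cats0 -cat1s mirror_cat.
have -> : cup_word t Leaf = [:: Slice 0 Cup] ++ btree_word 0 t by [].
have cW : cod 0 (x ++ shift 1 V) = Some 2%N.
  by rewrite cod_cat cx /=; have := @cod_shift 1 0 _ _ _ cV; rewrite !addn0.
have [z zE] := act_strand Q0 Qd rQ cW.
(* The trees [t] and [V] act on disjoint strings, so [V] may be drawn first. *)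
have -> : stateZ Q r (x ++ btree_word 0 t ++ shift k V ++ mirror y) =
    stateZ Q r ((x ++ shift 1 V) ++ btree_word 0 t ++ mirror y).
  rewrite /stateZ -catA !(act_cat _ _ x).
  apply: (@act_eq_size _ Q r _ k.+1 _ _ [::] cx) => -[|a o] // [szo].
  rewrite !catA (act_cat _ _ (_ ++ shift k V)) (act_cat _ _ (shift 1 V ++ _)).
  exact: (@act_exchange _ Q r _ V k _ [:: a] o).
rewrite /stateZ [x ++ _ ++ [:: _]]catA !(act_cat _ _ (x ++ shift 1 V)) !zE.
rewrite -catA (act_cat _ _ [:: Slice 0 Cup] (btree_word 0 t ++ mirror y)).
have -> : act Q r [:: Slice 0 Cup] (act Q r [:: Slice 0 Cap] (fun=> 1)) [::] = d%:C%C.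
  by rewrite -act_cat -(stateZ_loop r Q0 Qd).
have d0 : d%:C%C != 0 :> C.
  by rewrite fmorph_eq0 gt_eqF // (lt_trans ltr01 d_gt1).
by field.
Qed.

Lemma gluing_form_sumr k (x : {freeg (diagram 0 k) / C}) y :
  gluing_form d x y = \sum_(v <- dom y) (coeff v y)^* * gluing_form d x << v >>.
Proof.
rewrite (gluing_form_conj d_gt1) gluing_form_suml rmorph_sum; apply: eq_bigr => v _.
by rewrite rmorphM /= -(gluing_form_conj d_gt1).
Qed.

(* The leaves of [f] and [f'] are matched so that all of [x] except its first
   string is absorbed by the last tree of [f'], and all of [y] except its last
   string by the first tree of [f]: what is left of [x] lies in the
   one-dimensional space of diagrams with two ends. *)
Lemma pairing_contract t u : exists N (f f' : forest (leaves t + leaves u) N),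
  (0 < N)%N /\ forall x y : Cspace d (leaves t + leaves u),
    pairing (forest_map f x) (forest_map f' y) =
    d%:C%C^-1 * pairing x (cup_vector t u) * pairing (cup_vector t u) y.
Proof.
have [Q [r [Q0 Qd rQ]]] := quantum_parameter d_gt1.
have [t' [t'E tE]] := act_cup_word_leafr r Q0 t u.
have [u' [u'E uE]] := act_cup_word_leafl r Q0 t u.
have := cup_vectorE t u; set c := cup_vector t u.
rewrite /cup_diagram; move: (introT _ _); move: c.
move: t'E u'E; set n := (leaves t + leaves u)%N; move=> t'E u'E c cw cE.
pose k := n.-1; have nE : n = k.+1 by rewrite /k -t'E.
(* With k = n - 1, [t'] and [u'] have k leaves: [f] grafts [t'] on the first leaf, [f'] grafts [u']
   on the last, and both results have 2k leaves. *)
have f_subproof : (size (t' :: nseq k Leaf) == n) &&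
    (sumn (map leaves (t' :: nseq k Leaf)) == (k + k)%N).
  by rewrite /= sumn_leaves size_nseq; apply/andP; split; apply/eqP; lia.
have f'_subproof : (size (nseq k Leaf ++ [:: u']) == n) &&
    (sumn (map leaves (nseq k Leaf ++ [:: u'])) == (k + k)%N).
  rewrite map_cat sumn_cat sumn_leaves size_cat size_nseq /=.
  by apply/andP; split; apply/eqP; lia.
exists (k + k)%N, (mk_forest f_subproof), (mk_forest f'_subproof); split.
  by have := leaves_gt0 t'; lia.
have cu : cod 0 (cup_word Leaf u') == Some n by rewrite cod_cup_word add1n u'E.
have ct : cod 0 (cup_word t' Leaf) == Some n by rewrite cod_cup_word addn1 t'E.
have cuE : c = cls << mk_diagram cu >>.
  by rewrite cE; apply: (eq_cls_of_act d_gt1 Q0 Qd rQ) => G; apply: uE.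
have ctE : c = cls << mk_diagram ct >>.
  by rewrite cE; apply: (eq_cls_of_act d_gt1 Q0 Qd rQ) => G; apply: tE.
move=> x y; rewrite {1}cuE ctE -(reprK_cls x) -(reprK_cls y).
rewrite /forest_map !(Cspace_map_cls d_gt1) !(pairing_cls d_gt1) (gluing_form_map2 d_gt1).
rewrite (gluing_form_suml _ _ (<< _ >>)) (gluing_form_sumr (<< _ >>)).
rewrite -mulrA mulr_suml mulr_sumr.
apply: eq_bigr => v _; rewrite 2!mulr_sumr; apply: eq_bigr => w _.
rewrite !gluing_formU !(evaluationE Q0 Qd rQ) /= forest_word_leaves0 forest_word_leaves /=.
rewrite -catA (@stateZ_contract Q r _ _ k) //; first by ring.
- by rewrite (eqP (valP v)) nE.
- by apply/eqP; rewrite -eqSS t'E nE.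
- by apply/eqP; rewrite -eqSS u'E nE.
Qed.

End Contraction.

(** * Thompson's group *)

Section Points.
Variable R : realType.
Implicit Types (a w x th : R) (t u : btree) (f : seq btree).

(** Leaf number and relative position are coordinates on the circle: a Thompson map adds [k] to the
    first and keeps the second. *)
Definition point t i th : R :=
  let aw := nth (0, 1) (dyadic_intervals 0 1 t) i in aw.1 + th * aw.2.

Lemma size_dyadic a w t : size (dyadic_intervals a w t) = leaves t.
Proof. by elim: t a w => //= l IHl r IHr a w; rewrite size_cat IHl IHr. Qed.

Lemma dyadic_affine a w b v t : dyadic_intervals (a + w * b) (w * v) t =
  [seq (a + w * p.1, w * p.2) | p <- dyadic_intervals b v t].
Proof.
elim: t b v => //= l IHl r IHr b v; rewrite map_cat -IHl -IHr !mulrDr !mulrA.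
by rewrite addrA.
Qed.

Lemma dyadic_bounds a w t i : 0 < w -> (i < leaves t)%N ->
  let aw := nth (0, 1) (dyadic_intervals a w t) i in
  [/\ a <= aw.1, aw.1 + aw.2 <= a + w & 0 < aw.2].
Proof.
elim: t a w i => [|l IHl r IHr] a w i w0 /=; first by case: i.
have w20 : 0 < w / 2 by rewrite divr_gt0.
rewrite nth_cat size_dyadic; case: (ltnP i (leaves l)) => ir il.
  by have [] := IHl a _ _ w20 ir; split=> //; lra.
by have [] := IHr (a + w / 2) _ (i - leaves l)%N w20 ltac:(lia); split=> //; lra.
Qed.

Definition covers x : pred (R * R) := fun aw => aw.1 <= x < aw.1 + aw.2.

Lemma find_covers a w t i th : 0 < w -> (i < leaves t)%N -> 0 <= th < 1 ->
  let aw := nth (0, 1) (dyadic_intervals a w t) i in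
  find (covers (aw.1 + th * aw.2)) (dyadic_intervals a w t) = i.
Proof.
move=> w0 it /andP[th0 th1] aw.
have [a_le le_w aw0] := dyadic_bounds a w0 it; rewrite -/aw in a_le le_w aw0.
set x := aw.1 + _.
have x_ge : aw.1 <= x by rewrite /x lerDl mulr_ge0 // ltW.
have x_lt : x < aw.1 + aw.2 by rewrite /x ltrD2l gtr_pMl.
move: x_ge x_lt; clearbody x; rewrite /aw; clear aw a_le le_w aw0 th th0 th1.
elim: t a w i w0 it => [|l IHl r IHr] a w i w0 /=.
  by case: i => //= _ xa xw; rewrite /covers /= xa xw.
have w20 : 0 < w / 2 by rewrite divr_gt0.
rewrite nth_cat size_dyadic find_cat; case: (ltnP i (leaves l)) => ir il xa xw.
  have fE := IHl _ _ _ w20 ir xa xw.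
  by rewrite has_find fE size_dyadic ir.
have il' : (i - leaves l < leaves r)%N by lia.
rewrite (IHr _ _ _ w20 il' xa xw) size_dyadic subnKC // ifF //.
apply/negbTE/hasPn => p /(nthP (0, 1))[j]; rewrite size_dyadic => jl <-.
have [_ le1 _] := dyadic_bounds a w20 jl.
have [ge2 _ _] := dyadic_bounds (a + w / 2) w20 il'.
by apply/negP => /andP[_] /lt_le_trans/(_ le1); rewrite ltNge (le_trans ge2).
Qed.

Lemma dyadic_cover a w t x : 0 < w -> a <= x < a + w ->
  exists i th, [/\ (i < leaves t)%N, 0 <= th < 1 &
    let aw := nth (0, 1) (dyadic_intervals a w t) i in x = aw.1 + th * aw.2].
Proof.
elim: t a w => [|l IHl r IHr] a w w0 /=.
  move=> /andP[ax xw]; exists 0%N, ((x - a) / w); split=> //=.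
    by rewrite divr_ge0 ?subr_ge0 // ?(ltW w0) //= ltr_pdivrMr // mul1r ltrBlDl.
  by rewrite divfK ?gt_eqF // subrKC.
have w20 : 0 < w / 2 by rewrite divr_gt0.
move=> /andP[ax xw]; have [xw2|xw2] := ltP x (a + w / 2).
  have [|i [th [il th01 xE]]] := IHl a _ w20; first by rewrite ax.
  exists i, th; split=> //; first by lia.
  by rewrite nth_cat size_dyadic il.
have [|i [th [il th01 xE]]] := IHr (a + w / 2) _ w20; first by rewrite xw2 /=; lra.
exists (leaves l + i)%N, th; split=> //; first by lia.
by rewrite nth_cat size_dyadic ltnNge leq_addr /= addKn.
Qed.

Lemma pointP t x : 0 <= x < 1 ->
  exists i th, [/\ (i < leaves t)%N, 0 <= th < 1 & x = point t i th].
Proof. by move=> x01; apply: dyadic_cover => //; rewrite add0r. Qed.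

Lemma thompson_map_point n (s : tree n) (k : 'I_n) (t : tree n) i th :
  (i < n)%N -> 0 <= th < 1 ->
  thompson_map s k t (point (val t) i th) = point (val s) ((i + k) %% n) th.
Proof.
move=> it th01; have it' : (i < leaves (val t))%N by rewrite (eqP (valP t)).
rewrite /thompson_map; have := find_covers (0 : R) ltr01 it' th01.
rewrite /= -/(point (val t) i th) /covers => ->; rewrite it /point.
have [_ _] := dyadic_bounds (0 : R) ltr01 it'.
case: (nth _ (dyadic_intervals 0 1 (val t)) i) => a w /= w0.
case: (nth _ _ _) => b v /=; rewrite [a + _]addrC addrK mulrACA divff ?gt_eqF //.
by rewrite mulr1.
Qed.

Lemma thompson_map_out n (s : tree n) (k : 'I_n) (t : tree n) x :
  ~~ (0 <= x < 1) -> thompson_map s k t x = x.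
Proof.
move=> x_out; rewrite /thompson_map ifF //; apply/negbTE; rewrite -leqNgt.
rewrite -{1}(eqP (valP t)) -(size_dyadic 0 1) leqNgt -has_find.
apply/hasPn => p /(nthP (0, 1))[j]; rewrite size_dyadic => jt <-.
have [a0 le1 _] := dyadic_bounds (0 : R) ltr01 jt.
by apply: contra x_out => /andP[xa xw]; apply/andP; split; lra.
Qed.

Lemma thompson_map_ext n m (s t : tree n) (s' t' : tree m) (k : 'I_n) (k' : 'I_m) :
  (forall x, 0 <= x < 1 -> thompson_map s k t x = thompson_map s' k' t' x) ->
  thompson_map (R := R) s k t = thompson_map s' k' t'.
Proof.
move=> E; apply/funext => x; have [/E//|x_out] := boolP (0 <= x < 1).
by rewrite !thompson_map_out.
Qed.

Lemma thompson_map_comp n (s t u : tree n) (k l m : 'I_n) : (l + k = m %[mod n])%N ->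
  thompson_map (R := R) s k t \o thompson_map t l u = thompson_map s m u.
Proof.
move=> lk; apply/funext => x /=; have [x01|x_out] := boolP (0 <= x < 1); last first.
  by rewrite !thompson_map_out.
have [i [th [iu th01 ->]]] := pointP (val u) x01.
have n0 : (0 < n)%N by apply: leq_ltn_trans (ltn_ord k).
rewrite (eqP (valP u)) in iu.
rewrite !thompson_map_point ?ltn_pmod //; congr point.
by rewrite modnDml -addnA -modnDmr lk modnDmr.
Qed.

Lemma thompson_map_id n (t : tree n) (k : 'I_n) : k = 0%N :> nat ->
  thompson_map (R := R) t k t = id.
Proof.
move=> k0; apply/funext => x; have [x01|x_out] := boolP (0 <= x < 1); last first.
  by rewrite !thompson_map_out.
have [i [th [iu th01 ->]]] := pointP (val t) x01; rewrite (eqP (valP t)) in iu.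
by rewrite thompson_map_point // k0 addn0 modn_small.
Qed.

Lemma dyadic_graft a w f t : size f = leaves t ->
  dyadic_intervals a w (graft_btree f t) =
  flatten [seq dyadic_intervals p.1.1 p.1.2 p.2 | p <- zip (dyadic_intervals a w t) f].
Proof.
elim: t a w f => [|l IHl r IHr] a w f /= szf.
  by case: f szf => [|u []] //= _; rewrite cats0.
have szl : size (take (leaves l) f) = leaves l by rewrite size_takel // szf leq_addr.
have szr : size (drop (leaves l) f) = leaves r by rewrite size_drop szf addKn.
rewrite IHl // IHr // -flatten_cat -map_cat -zip_cat ?size_dyadic //.
by rewrite cat_take_drop.
Qed.

Lemma point_graft f t i j th : size f = leaves t -> (i < leaves t)%N ->
  (j < leaves (nth Leaf f i))%N ->
  point (graft_btree f t) (flatten_index (map leaves f) i j) th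
  = point t i (point (nth Leaf f i) j th).
Proof.
move=> szf it jf; rewrite /point dyadic_graft //.
set ss := map _ _.
have shE : shape ss = map leaves f.
  rewrite /shape -map_comp (@eq_map _ _ _ (leaves \o snd)).
    by rewrite map_comp -/(unzip2 _) unzip2_zip // size_dyadic szf.
  by move=> p /=; rewrite size_dyadic.
have jf' : (j < nth 0 (map leaves f) i)%N by rewrite (nth_map Leaf) // szf.
rewrite nth_flatten shE flatten_indexKl // flatten_indexKr //.
rewrite (nth_map ((0, 1), Leaf)) ?size_zip ?size_dyadic ?szf ?minnn //.
rewrite nth_zip ?size_dyadic //=.
case: (nth _ (dyadic_intervals 0 1 t) i) => b v /=.
have := dyadic_affine b v 0 1 (nth Leaf f i); rewrite mulr0 addr0 mulr1 => ->.
rewrite (nth_map (0, 1)) ?size_dyadic //=; ring.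
Qed.

End Points.

(** * Rotation of blocks of leaves and common refinements of trees *)

Lemma nth_rotr (T : Type) (x0 : T) (s : seq T) i k : (i < size s)%N -> (k < size s)%N ->
  nth x0 (rotr k s) ((i + k) %% size s) = nth x0 s i.
Proof.
move=> si sk; rewrite /rotr /rot nth_cat size_drop subKn ?(ltnW sk) //.
have [ik|ik] := ltnP (i + k) (size s).
  rewrite modn_small // (_ : (i + k < k)%N = false) ?addnK ?nth_take //; lia.
have -> : ((i + k) %% size s = i + k - size s)%N.
  by rewrite -[in LHS](subnK ik) modnDr modn_small //; lia.
by rewrite ifT ?nth_drop; [congr nth|]; lia.
Qed.

Lemma flatten_index_lt sh i j : (i < size sh)%N -> (j < nth 0 sh i)%N ->
  (flatten_index sh i j < sumn sh)%N.
Proof.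
move=> si ji; rewrite -[in X in (_ < X)%N](cat_take_drop i sh) sumn_cat.
by rewrite (drop_nth 0) //= /flatten_index ltn_add2l ltn_addr.
Qed.

(** All leaves move by the same amount, the number of leaves in the last [k] blocks, which pass to
    the front. The two cases are the blocks that do not wrap around and those that do. *)
Lemma flatten_index_rotr sh i j k :
  (i < size sh)%N -> (j < nth 0 sh i)%N -> (k < size sh)%N ->
  flatten_index (rotr k sh) ((i + k) %% size sh) j =
  ((flatten_index sh i j + sumn (drop (size sh - k) sh)) %% sumn sh)%N.
Proof.
move=> si ji sk.
have sumE : sumn (rotr k sh) = sumn sh by apply/perm_sumn/permPl/perm_rotr.
have ltE : (flatten_index (rotr k sh) ((i + k) %% size sh) j < sumn sh)%N.
  rewrite -sumE; apply: flatten_index_lt; last by rewrite nth_rotr.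
  by rewrite size_rotr ltn_pmod //; apply: leq_ltn_trans sk.
rewrite -[LHS](modn_small ltE) /flatten_index /rotr /rot.
have [ik|ik] := ltnP (i + k) (size sh).
  have -> : ((i + k) %% size sh = i + k)%N by rewrite modn_small.
  rewrite take_cat size_drop subKn ?(ltnW sk) //.
  rewrite (_ : (i + k < k)%N = false) ?addnK; last by lia.
  rewrite take_takel; last by lia.
  by rewrite sumn_cat; congr modn; lia.
have -> : ((i + k) %% size sh = i + k - size sh)%N.
  by rewrite -[in LHS](subnK ik) modnDr modn_small //; lia.
rewrite take_cat size_drop subKn ?(ltnW sk) // ifT; last by lia.
have <- : (sumn (take (i + k - size sh) (drop (size sh - k) sh)) + j + sumn sh =
           sumn (take i sh) + j + sumn (drop (size sh - k) sh))%N; last by rewrite modnDr.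
rewrite -[in X in (_ + sumn X)%N](cat_take_drop (size sh - k) sh) sumn_cat.
have -> : take i sh = take (size sh - k) sh ++ take (i + k - size sh) (drop (size sh - k) sh).
  by rewrite -takeD; congr take; lia.
by rewrite sumn_cat; lia.
Qed.

Lemma graft_btree_leaves t : graft_btree (nseq (leaves t) Leaf) t = t.
Proof.
elim: t => //= l IHl r IHr.
by rewrite nseqD take_size_cat ?drop_size_cat ?size_nseq // IHl IHr.
Qed.

(** The overlay of the two trees: a leaf of one facing a subtree of the other is replaced by that
    subtree. *)
Lemma common_refinement t u : exists f g,
  [/\ size f = leaves t, size g = leaves u & graft_btree f t = graft_btree g u].
Proof.
elim: t u => [|l IHl r IHr] u.
  by exists [:: u], (nseq (leaves u) Leaf); rewrite size_nseq graft_btree_leaves.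
case: u => [|l' r'].
  exists (nseq (leaves (Node l r)) Leaf), [:: Node l r].
  by rewrite size_nseq graft_btree_leaves.
have [fl [gl [szfl szgl el]]] := IHl l'; have [fr [gr [szfr szgr er]]] := IHr r'.
exists (fl ++ fr), (gl ++ gr); rewrite !size_cat szfl szgl szfr szgr; split=> //=.
by rewrite !take_size_cat ?drop_size_cat // el er.
Qed.

Lemma tree_refinement n m (t : tree n) (u : tree m) :
  exists N (f : forest n N) (g : forest m N), graft f t = graft g u.
Proof.
have [f [g [szf szg fg]]] := common_refinement (val t) (val u).
have fP : (size f == n) && (sumn (map leaves f) == sumn (map leaves f)).
  by rewrite szf (eqP (valP t)) !eqxx.
have gP : (size g == m) && (sumn (map leaves g) == sumn (map leaves f)).
  by rewrite szg (eqP (valP u)) eqxx -(leaves_graft szf) -(leaves_graft szg) -fg eqxx.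
by exists (sumn (map leaves f)), (mk_forest fP), (mk_forest gP); apply: val_inj.
Qed.

Section ThompsonT.
Variable R : realType.

(** Each interval and its image are subdivided by the same tree, so the forest on the image side is
    rotated along with the intervals. *)
Lemma thompson_refine n N (s t : tree n) (k : 'I_n) (f f' : forest n N) :
  val f' = rotr k (val f) ->
  exists K : 'I_N, thompson_map (R := R) s k t = thompson_map (graft f' s) K (graft f t).
Proof.
case: f => f fP; case: f' => f' f'P /= f'E.
have [/eqP szf /eqP fN] := andP fP; have [/eqP szf' /eqP f'N] := andP f'P.
have kn := ltn_ord k; have n0 : (0 < n)%N by apply: leq_ltn_trans kn.
pose sh := map leaves f; have szsh : size sh = n by rewrite size_map.
have sh0 : (0 < nth 0%N sh 0)%N by rewrite (nth_map Leaf) ?szf // leaves_gt0.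
(* The new rotation number counts the leaves of the last [k] trees. It is less than [N] because k <
   n leaves out the first tree, which has at least one leaf. *)
have KN : (sumn (drop (n - k) sh) < N)%N.
  rewrite -fN -/sh -[in X in (_ < X)%N](cat_take_drop (n - k) sh) sumn_cat.
  rewrite -[X in (X < _)%N]add0n ltn_add2r.
  case: (sh) szsh sh0 => [|a sh'] /=; first by move=> n00; rewrite -n00 in n0.
  by move=> _ a0; rewrite -(subnSK kn) /= ltn_addr.
exists (Ordinal KN); apply: thompson_map_ext => x x01.
have [i [th [it th01 ->]]] := pointP (val t) x01.
have ti : (i < n)%N by rewrite -(eqP (valP t)).
have [j [th' [jf th'01 thE]]] := pointP (nth Leaf f i) th01.
rewrite thompson_map_point //.
have szft : size f = leaves (val t) by rewrite szf (eqP (valP t)).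
have szf's : size f' = leaves (val s) by rewrite szf' (eqP (valP s)).
have jsh : (j < nth 0 sh i)%N by rewrite (nth_map Leaf) ?szf.
have f'i : nth Leaf f' ((i + k) %% n) = nth Leaf f i.
  by have := @nth_rotr _ Leaf f i k; rewrite szf f'E => ->.
rewrite {1}thE -[in LHS]f'i -point_graft //; first last.
- by rewrite f'i.
- by rewrite (eqP (valP s)) ltn_pmod.
rewrite thE -point_graft // thompson_map_point //=; last first.
  by rewrite -fN; apply: flatten_index_lt; rewrite ?szsh.
have := @flatten_index_rotr sh i j k; rewrite szsh f'E map_rotr => -> //.
by rewrite -/sh fN.
Qed.

Lemma thompsonT_comp g h : thompsonT R g -> thompsonT R h -> thompsonT R (g \o h).
Proof.
move=> [n [s [k [t ->]]]] [m [t' [l [u ->]]]].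
(* The source tree of the outer map and the target tree of the inner one are refined to the same
   tree; [thompson_refine] carries each refinement to the other side. *)
have [N [f [f' ff']]] := tree_refinement t t'.
have [/eqP szf /eqP fN] := andP (valP f); have [/eqP szf' /eqP f'N] := andP (valP f').
have f1P : (size (rotr k (val f)) == n) && (sumn (map leaves (rotr k (val f))) == N).
  rewrite size_rotr szf eqxx /= map_rotr -[X in _ == X]fN; apply/eqP.
  exact/perm_sumn/permPl/perm_rotr.
have f2P : (size (rot l (val f')) == m) && (sumn (map leaves (rot l (val f'))) == N).
  rewrite size_rot szf' eqxx /= map_rot -[X in _ == X]f'N; apply/eqP.
  exact/perm_sumn/permPl/perm_rot.
have [K ->] := @thompson_refine _ _ s t k f (mk_forest f1P) erefl.
have [L ->] := @thompson_refine _ _ t' u l (mk_forest f2P) f' (esym (rotK l _)).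
have N0 : (0 < N)%N by apply: leq_ltn_trans (ltn_ord K).
pose M := Ordinal (ltn_pmod (L + K) N0).
rewrite -ff' (@thompson_map_comp _ _ _ _ _ _ _ M) //=; last by rewrite modn_mod.
by exists N, (graft (mk_forest f1P) s), M, (graft (mk_forest f2P) u).
Qed.

Lemma thompsonT_inv g : thompsonT R g ->
  exists2 h, thompsonT R h & [/\ g \o h = id & h \o g = id].
Proof.
move=> [n [s [k [t ->]]]]; have n0 : (0 < n)%N by apply: leq_ltn_trans (ltn_ord k).
pose z := Ordinal n0; pose l := Ordinal (ltn_pmod (n - k) n0).
have kn := ltn_ord k.
exists (thompson_map t l s); first by exists n, t, l, s.
split.
- rewrite (@thompson_map_comp _ _ _ _ _ _ _ z) ?thompson_map_id //=.
  by rewrite modnDml subnK ?modnn ?mod0n // ltnW.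
- rewrite (@thompson_map_comp _ _ _ _ _ _ _ z) ?thompson_map_id //=.
  by rewrite modnDmr subnKC ?modnn ?mod0n // ltnW.
Qed.

End ThompsonT.

(** * Hilbert spaces *)

Section HilbertSpace.
Variables (R : realType) (H : completeNormedModType R[i]) (ip : {dot H for (@Num.conj R[i])}).
Local Notation C := R[i].
Hypothesis hH : hilbert_norm ip.
Implicit Types (u v w : H) (z : C).

(* Squared moduli and norms are taken in [R], since [R[i]] is only partially ordered. *)
Definition sqC z : R := complex.Re z ^+ 2 + complex.Im z ^+ 2.
Definition sqH v : R := complex.Re (ip v v).

Lemma sqCE z : z * z^* = (sqC z)%:C%C.
Proof.
case: z => a b; apply/eqP; rewrite eq_complex /sqC /=.
by apply/andP; split; apply/eqP; ring.
Qed.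

Lemma sqC_ge0 z : 0 <= sqC z.
Proof. by rewrite addr_ge0 // sqr_ge0. Qed.

Lemma sqC_eq0 z : sqC z = 0 -> z = 0.
Proof.
case: z => a b /eqP; rewrite /sqC /= paddr_eq0 ?sqr_ge0 // !sqrf_eq0.
by move=> /andP[/eqP-> /eqP->].
Qed.

Lemma sqC0 : sqC 0 = 0. Proof. by rewrite /sqC /= expr0n addr0. Qed.

Lemma sqCN z : sqC (- z) = sqC z.
Proof. by case: z => a b; rewrite /sqC /= !sqrrN. Qed.

Lemma sqCM z1 z2 : sqC (z1 * z2) = sqC z1 * sqC z2.
Proof. by case: z1 z2 => a b [a' b']; rewrite /sqC /=; ring. Qed.

Lemma sqCD z1 z2 : sqC (z1 + z2) <= 2 * sqC z1 + 2 * sqC z2.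
Proof.
case: z1 z2 => a b [a' b']; rewrite /sqC /=.
have := sqr_ge0 (a - a'); have := sqr_ge0 (b - b'); rewrite !expr2; lra.
Qed.

Lemma sqC_conj z : sqC z^* = sqC z.
Proof. by case: z => a b; rewrite /sqC /= sqrrN. Qed.

Lemma sqHE v : ip v v = (sqH v)%:C%C.
Proof.
have := dnorm_ge0 ip v; rewrite /sqH; case: (ip v v) => a b.
by rewrite lecE /= => /andP[/eqP-> _].
Qed.

Lemma sqH_ge0 v : 0 <= sqH v.
Proof. by have := dnorm_ge0 ip v; rewrite sqHE lecR. Qed.

Lemma sqH_eq0 v : sqH v = 0 -> v = 0.
Proof. by move=> v0; apply/eqP; rewrite -(dnorm_eq0 ip) sqHE v0. Qed.

Lemma ip_conj u v : ip v u = (ip u v)^*.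
Proof. by rewrite (hermC ip) mul1r. Qed.

Lemma ipZl c u v : ip (c *: u) v = c * ip u v.
Proof. exact: linearZl_LR. Qed.

Lemma ipZr c u v : ip u (c *: v) = c^* * ip u v.
Proof. exact: linearZr_LR. Qed.

Lemma sqH_sub_proj u w : w != 0 ->
  sqH (u - (ip u w / ip w w) *: w) = sqH u - sqC (ip u w) / sqH w.
Proof.
move=> w0; have q0 : ip w w != 0 by rewrite dnorm_eq0.
have qC : (ip w w)^* = ip w w by rewrite -ip_conj.
apply: (@complexI R); rewrite -sqHE rmorphB fmorph_div /= -sqCE -!sqHE.
rewrite !(linearBl, linearBr) /= !(ipZl, ipZr).
rewrite (ip_conj u w) rmorphM fmorphV /= qC; field; exact: q0.
Qed.

(** Take for [c] the coefficient of the projection to [w], which minimizes the distance from [u] to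
    the line of [w]. *)
Lemma variational a u w : (forall c : C, a <= sqH (u - c *: w)) ->
  sqC (ip u w) <= sqH w * (sqH u - a).
Proof.
move=> a_min; have [->|w0] := eqVneq w 0.
  by rewrite /sqH !linear0r /= sqC0 mul0r.
have sw0 : 0 < sqH w.
  by rewrite lt_neqAle sqH_ge0 andbT eq_sym; apply: contra_neq w0; apply: sqH_eq0.
have := a_min (ip u w / ip w w); rewrite sqH_sub_proj // lerBrDr -lerBrDl.
by rewrite ler_pdivrMr // mulrC.
Qed.

Lemma sqC_ip u v : sqC (ip u v) <= sqH u * sqH v.
Proof.
have := @variational 0 u v (fun c => sqH_ge0 _).
by rewrite subr0 mulrC.
Qed.

(** The parallelogram law with one term dropped; it replaces the triangle inequality for squared
    norms. *)
Lemma sqHD u v : sqH (u + v) <= 2 * sqH u + 2 * sqH v.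
Proof.
have := sqH_ge0 (u - v).
have E : sqH (u + v) + sqH (u - v) = 2 * sqH u + 2 * sqH v.
  apply: (@complexI R); rewrite !mulr_natl !rmorphD /= -!sqHE.
  by rewrite !dnormD /= hnormN linearNr rmorphN /=; ring.
by lra.
Qed.

Lemma sqHN v : sqH (- v) = sqH v.
Proof. by rewrite /sqH hnormN. Qed.

Lemma sqHZ (c : C) v : sqH (c *: v) = sqC c * sqH v.
Proof.
apply: (@complexI R); rewrite rmorphM /= -!sqHE -sqCE.
by rewrite ipZl ipZr mulrA.
Qed.

Lemma closure_sqHP (A : set H) v :
  closure A v <-> forall e : R, 0 < e -> exists2 a, A a & sqH (v - a) < e.
Proof.
have normE w (e : R) : 0 < e -> (`|w| < (Num.sqrt e)%:C%C) = (sqH w < e).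
  move=> e0; rewrite -[LHS](@ltr_pXn2r _ 2) ?nnegrE //; last first.
    by rewrite lecR sqrtr_ge0.
  by rewrite hH sqHE -rmorphXn /= sqr_sqrtr ?(ltW e0) // ltcR.
split=> [Av e e0|Av B].
  have [|a [Aa]] := Av (ball v (Num.sqrt e)%:C%C).
    by apply: nbhsx_ballx; rewrite ltcR sqrtr_gt0.
  by rewrite -ball_normE /= normE // => ve; exists a.
move=> /nbhs_ballP[e /= e0 eB].
(* A positive element of [R[i]] is real, so the radius comes from [R]. *)
have [er0 eE] : 0 < complex.Re e /\ e = (complex.Re e)%:C%C.
  by case: e e0 {eB} => a b; rewrite ltcE /= => /andP[/eqP-> ->].
have [|a Aa ve] := Av (complex.Re e ^+ 2); first by rewrite exprn_gt0.
exists a; split=> //; apply: eB; rewrite -ball_normE /=.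
by move: ve; rewrite -normE ?exprn_gt0 // sqrtr_sqr (gtr0_norm er0) -eE.
Qed.

Lemma small_multiple (K e : R) : 0 <= K -> 0 < e -> exists h, [/\ 0 < h, h <= 1 & K * h < e].
Proof.
move=> K0 e0; have K1 : 0 < K + 1 by rewrite ltr_wpDl.
exists (Num.min 1 (e / (K + 1))); split.
- by rewrite lt_min ltr01 divr_gt0.
- by rewrite ge_min lexx.
- have le_e : (K + 1) * Num.min 1 (e / (K + 1)) <= e.
    by rewrite mulrC -ler_pdivlMr // ge_min lexx orbT.
  apply: lt_le_trans le_e; rewrite ltr_pM2r ?ltrDl //.
  by rewrite lt_min ltr01 divr_gt0.
Qed.

(* If the distance from [psi] to [W] were positive, a nearly minimizing residue
   [a] would be nearly orthogonal to [W], hence, by the weak limit hypothesis, to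
   [psi], hence to itself. *)
Lemma mem_of_weak_limit (W : set H) (psi w : H) : closed_subspace W ->
  ip w psi != 0 ->
  (forall v (e : R), 0 < e -> exists w', [/\ W w', sqH w' <= sqH w &
     sqC (ip w' v - ip w psi * ip psi v) < e]) -> W psi.
Proof.
move=> [W0 WD clW] wpsi limW.
pose D := [set sqH (psi - a) | a in W]; pose delta := inf D.
have hasD : has_inf D.
  by split; [exists (sqH (psi - 0)), 0 | exists 0 => _ [a _ <-]; apply: sqH_ge0].
have delta_le a : W a -> delta <= sqH (psi - a).
  by move=> Wa; apply: ge_inf; [case: hasD | exists a].
have delta_ge0 : 0 <= delta.
  by apply: lb_le_inf; [case: hasD | move=> _ [a _ <-]; apply: sqH_ge0].
have near_min e : 0 < e -> exists2 a, W a & sqH (psi - a) < delta + e.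
  by move=> e0; have [_ [a Wa <-] lt_a] := inf_adherent e0 hasD; exists a.
have alpha0 : 0 < sqC (ip w psi).
  rewrite lt_neqAle sqC_ge0 andbT eq_sym.
  by apply: contra_neq wpsi; apply: sqC_eq0.
suff delta0 : delta = 0.
  apply: clW; apply/closure_sqHP => e /near_min.
  by rewrite delta0 add0r.
(* [K] gathers the coefficients of [e] in the final bound sqH a ^+ 2 <= K * e; a choice with K * e <
   delta ^+ 2 contradicts delta <= sqH a. *)
pose K := 4 * (sqH w + 1) / sqC (ip w psi) + 4 * sqH psi + 4 * delta + 4.
have K0 : 0 <= K.
  have : 0 <= 4 * (sqH w + 1) / sqC (ip w psi).
    by apply: divr_ge0 (ltW alpha0); rewrite mulr_ge0 ?addr_ge0 ?sqH_ge0 ?ler0n ?ler01.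
  by have := sqH_ge0 psi; rewrite /K; lra.
apply/eqP; rewrite eq_le delta_ge0 andbT leNgt; apply/negP => delta_gt0.
have [e [e0 e1 Ke]] := small_multiple K0 (exprn_gt0 2 delta_gt0).
have [w0 Ww0 lt_w0] := near_min e e0.
pose a := psi - w0.
have orth w' : W w' -> sqC (ip w' a) <= sqH w' * e.
  move=> Ww'; rewrite ip_conj sqC_conj.
  have := @variational delta a w'; rewrite -/a => /(_ _)/le_trans; apply.
    by move=> c; rewrite /a -addrA -opprD; apply: delta_le; rewrite addrC; apply: WD.
  rewrite ler_wpM2l ?sqH_ge0 //.
  by move: lt_w0; rewrite -/a; lra.
have [w' [Ww' le_w' lim_w']] := limW a e e0.
have psi_a : sqC (ip psi a) <= 2 * (sqH w + 1) * e / sqC (ip w psi).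
  rewrite ler_pdivlMr // mulrC -sqCM.
  have := sqCD (ip w' a) (- (ip w' a - ip w psi * ip psi a)).
  rewrite sqCN opprB addrC subrK => /le_trans; apply.
  have := orth _ Ww'; have : sqH w' * e <= sqH w * e by rewrite ler_pM2r.
  by move: lim_w'; lra.
have sq_a : sqH a ^+ 2 <= 2 * sqC (ip psi a) + 2 * sqC (ip w0 a).
  have := sqCD (ip psi a) (- ip w0 a); rewrite sqCN -linearBl /= -/a.
  by rewrite {1}/sqC sqHE /= expr0n addr0.
have w0_a := orth _ Ww0.
have w0_le : sqH w0 <= 2 * sqH psi + 2 * (delta + 1).
  have := sqHD psi (- a); rewrite sqHN opprB addrC subrK.
  by move: lt_w0; rewrite -/a; lra.
have : sqH a ^+ 2 <= K * e.
  have : sqH w0 * e <= (2 * sqH psi + 2 * (delta + 1)) * e by rewrite ler_pM2r.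
  have KE : K * e = 2 * (2 * (sqH w + 1) * e / sqC (ip w psi))
                    + 2 * ((2 * sqH psi + 2 * (delta + 1)) * e).
    by rewrite /K; field; rewrite gt_eqF.
  by rewrite KE; lra.
have : delta ^+ 2 <= sqH a ^+ 2 by rewrite ler_pXn2r ?nnegrE ?sqH_ge0 //; apply: delta_le.
lra.
Qed.

End HilbertSpace.

(** * Irreducibility *)

Section Closure.
Variables (R : realType) (H : completeNormedModType R[i]) (ip : {dot H for (@Num.conj R[i])}).
Hypothesis hH : hilbert_norm ip.
Local Notation sqH := (sqH ip).

Lemma linear_span_lin (A : set H) c u v :
  linear_span A u -> linear_span A v -> linear_span A (c *: u + v).
Proof.
move=> [n [a [x [xA ->]]]] [m [b [y [yA ->]]]].
pose ab (k : 'I_(n + m)) := match fintype.split k with inl i => c * a i | inr j => b j end.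
pose xy (k : 'I_(n + m)) := match fintype.split k with inl i => x i | inr j => y j end.
exists (n + m)%N, ab, xy; split.
  by move=> k; rewrite /xy; case: (fintype.split k).
rewrite big_split_ord scaler_sumr /=; congr (_ + _); apply: eq_bigr => i _.
  by rewrite /ab /xy (unsplitK (inl i)) scalerA.
by rewrite /ab /xy (unsplitK (inr i)).
Qed.

Lemma closed_subspace_span (A : set H) : closed_subspace (closed_span A).
Proof.
split; last exact: closed_closure.
- apply: subset_closure; exists 0%N, (fun=> 0), (fun=> 0).
  by split; [case | rewrite big_ord0].
- move=> c u v /(closure_sqHP hH) Vu /(closure_sqHP hH) Vv.
  apply/(closure_sqHP hH) => e e0.
  have K0 : 0 <= 2 * sqC c + 2 by rewrite addr_ge0 ?mulr_ge0 ?sqC_ge0 ?ler0n.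
  have [h [h0 _ Kh]] := small_multiple K0 e0.
  have [u' Au' uu'] := Vu h h0; have [v' Av' vv'] := Vv h h0.
  exists (c *: u' + v'); first exact: linear_span_lin.
  rewrite opprD addrACA -scalerBr; apply: le_lt_trans (sqHD _ _ _) _.
  rewrite sqHZ; have : sqC c * sqH (u - u') <= sqC c * h.
    by rewrite ler_wpM2l ?sqC_ge0 ?ltW.
  by move: Kh; lra.
Qed.

Lemma sub_closed_span (A W : set H) : closed_subspace W -> A `<=` W -> closed_span A `<=` W.
Proof.
move=> [W0 WD clW] AW; apply: subset_trans clW; apply: closureS.
move=> _ [n [a [u [uA ->]]]]; apply: (big_ind W) => //.
  by move=> x y Wx Wy; rewrite -[x]scale1r; apply: WD.
by move=> i _; rewrite -[_ *: _]addr0; apply: WD => //; apply: AW.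
Qed.

(** By Pythagoras, [w] is at squared distance at least [sqH w] from every combination of elements of
    [A], so it cannot be approximated by them unless it is 0. *)
Lemma orthogonal_closed_span (A : set H) w :
  closed_span A w -> (forall a, A a -> ip w a = 0) -> w = 0.
Proof.
move=> /(closure_sqHP hH) Aw wA; apply: (@sqH_eq0 _ _ ip); apply/eqP.
rewrite eq_le sqH_ge0 andbT leNgt; apply/negP => /Aw[_ [n [a [u [uA ->]]]]].
apply/negP; rewrite -leNgt.
have w0 : ip w (\sum_(i < n) a i *: u i) = 0.
  by rewrite linear_sumr big1 // => i _; rewrite linearZr_LR /= wA ?mulr0.
set s := \sum_(i < n) _ in w0 *; have := sqH_ge0 ip s.
have -> : sqH (w - s) = sqH w + sqH s.
  by apply: (@complexI R); rewrite rmorphD /= -!sqHE hnormBd.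
by lra.
Qed.

End Closure.

Section Irreducible.
Variables (R : realType) (d : R).
Hypothesis d_gt1 : 1 < d.
Local Notation C := R[i].
Variables (H : completeNormedModType C) (ip : {dot H for (@Num.conj C)}).
Hypothesis hH : hilbert_norm ip.
Variable iota : forall n, tree n -> {linear Cspace d n -> H}.
Hypothesis hiota : direct_limit_completion ip iota.
Variable piY : (R -> R) -> {linear H -> H}.
Hypothesis hpiY : thompson_representation ip iota piY.
Local Notation sqH := (sqH ip).
Let Psi := vacuum iota.
Let s : C := ((Num.sqrt d)^-1)%:C%C.

Let ss : s * s^* = d%:C%C^-1.
Proof.
have d0 : 0 <= d by rewrite ltW // (lt_trans ltr01).
rewrite /s sqCE /sqC /= expr0n addr0 exprVn sqr_sqrtr //.
by rewrite fmorphV.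
Qed.

Lemma sqH_unitary g v : thompsonT R g -> sqH (piY g v) = sqH v.
Proof. by move=> /(rep_unitary hpiY)[U _]; rewrite /sqH U. Qed.

Lemma vacuum_cup t u : Psi = s *: iota (graft (forest2 t u) caret) (cup_vector d t u).
Proof. by rewrite /Psi /vacuum linearZ /= -(limit_connect hiota caret (forest2 t u)). Qed.

Lemma sqH_vacuum : sqH Psi = 1.
Proof.
have [Q [r [Q0 Qd rQ]]] := quantum_parameter d_gt1.
apply: (@complexI R); rewrite -sqHE /Psi /vacuum linearZ /= ipZl ipZr.
rewrite (limit_isometry hiota) (pairing_cls d_gt1) gluing_formU mulrA -/s ss.
rewrite (evaluationE Q0 Qd rQ) /=.
rewrite (stateZ_loop r Q0 Qd).
by rewrite mulVf // fmorph_eq0 gt_eqF // (lt_trans ltr01).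
Qed.

Lemma forest_of_pair N (g : forest 2 N) : exists t u, exists e : (leaves t + leaves u)%N = N,
  g = ecast m (forest 2 m) e (forest2 t u).
Proof.
case: g => -[|t [|u [|]]] //= gP; exists t, u.
have e : (leaves t + leaves u)%N = N by rewrite -(eqP gP) addn0.
exists e.
by case: N / e gP => gP; apply: val_inj.
Qed.

Lemma dense_tree u v (e : R) : 0 < e -> exists t1 t2 (x y : Cspace d (leaves t1 + leaves t2)),
  let t := graft (forest2 t1 t2) caret in
  sqH (u - iota t x) < e /\ sqH (v - iota t y) < e.
Proof.
move=> e0.
have dense w : exists n (t : tree n) x, sqH (w - iota t x) < e.
  have : closure [set v | exists n (t : tree n) (x : Cspace d n), v = iota t x] w.
    by rewrite (limit_dense hiota).
  by move=> /(closure_sqHP hH)/(_ e e0)[_ [n [t [x ->]]] lt_e]; exists n, t, x.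
have [n [t [x ux]]] := dense u; have [m [t' [y vy]]] := dense v.
have [N [f [f' ff']]] := tree_refinement t t'.
(* Refining the caret too gives a common tree of the shape [Node t1 t2], as [pairing_contract]
   requires. *)
have [N' [g [g' gg']]] := tree_refinement (graft f t) caret.
have [t1 [t2 [eN g'E]]] := forest_of_pair g'.
case: N' / eN g g' gg' g'E => g g' gg' /= g'E.
exists t1, t2, (forest_map g (forest_map f x)), (forest_map g (forest_map f' y)).
rewrite /= -g'E -gg'; split; first by rewrite !(limit_connect hiota).
by rewrite (limit_connect hiota) ff' (limit_connect hiota).
Qed.

(** The element has rotation number 0, so it lies in F. Refining [t] by [f] in the first argument
    and by [f'] in the second puts both vectors on the same tree, where [pairing_contract] applies;
    the two factors d^(-1/2) of the vacuum supply 1/d through [ss]. *)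
Lemma tree_contract t1 t2 (x y : Cspace d (leaves t1 + leaves t2)) :
  exists2 g, thompsonT R g &
    let t := graft (forest2 t1 t2) caret in
    ip (piY g (iota t x)) (iota t y) = ip (iota t x) Psi * ip Psi (iota t y).
Proof.
have [N [f [f' [N0 ff']]]] := pairing_contract d_gt1 t1 t2.
set t := graft (forest2 t1 t2) caret.
exists (thompson_map (graft f' t) (Ordinal N0) (graft f t)).
  by exists N, (graft f' t), (Ordinal N0), (graft f t).
rewrite /= -(limit_connect hiota t f x) (rep_limit hpiY) /=.
rewrite -(limit_connect hiota t f' y) (limit_isometry hiota) ff'.
rewrite (limit_connect hiota) (limit_connect hiota) (vacuum_cup t1 t2).
rewrite ipZl ipZr !(limit_isometry hiota) -ss.
ring.
Qed.

Lemma weak_limit_vacuum u v (e : R) : 0 < e -> exists2 g, thompsonT R g &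
  sqC (ip (piY g u) v - ip u Psi * ip Psi v) < e.
Proof.
move=> e0.
(* The bounds h * sqH v and (2 * sqH u + 2) * h each occur twice, and the nested uses of [sqCD] cost
   a factor 4, hence 8. *)
pose K := 8 * (sqH v + (2 * sqH u + 2)).
have K0 : 0 <= K by have := sqH_ge0 ip u; have := sqH_ge0 ip v; rewrite /K; lra.
have [h [h0 h1 Kh]] := small_multiple K0 e0.
have [t1 [t2 [x [y [ux vy]]]]] := dense_tree u v h0.
have [g gT] := tree_contract x y; set t := graft _ _.
move: ux vy; rewrite -/t; set u' := iota t x; set v' := iota t y => uu' vv' /= gE.
exists g => //.
(* The identity is exact on [u'] and [v']; what remains is four terms, each with a small difference
   as a factor. *)
have -> : ip (piY g u) v - ip u Psi * ip Psi v =
    (ip (piY g (u - u')) v + ip (piY g u') (v - v'))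
    + (- (ip (u - u') Psi * ip Psi v) + - (ip u' Psi * ip Psi (v - v'))).
  rewrite linearB /= !(linearBl, linearBr) /=.
  have -> : ip (piY g u') v' = ip u' Psi * ip Psi v' by [].
  by ring.
have u'_le : sqH u' <= 2 * sqH u + 2.
  have := sqHD ip u (- (u - u')); rewrite sqHN opprB addrC subrK.
  by move: uu' h1; lra.
apply: le_lt_trans (sqCD _ _) _.
have b1 : sqC (ip (piY g (u - u')) v) <= h * sqH v.
  apply: le_trans (sqC_ip _ _ _) _.
  by rewrite ler_wpM2r ?sqH_ge0 // sqH_unitary // ltW.
have b2 : sqC (ip (piY g u') (v - v')) <= (2 * sqH u + 2) * h.
  apply: le_trans (sqC_ip _ _ _) _.
  by rewrite ler_pM ?sqH_ge0 // ?sqH_unitary // ltW.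
have b3 : sqC (- (ip (u - u') Psi * ip Psi v)) <= h * sqH v.
  rewrite sqCN sqCM ler_pM ?sqC_ge0 //.
    by apply: le_trans (sqC_ip _ _ _) _; rewrite sqH_vacuum mulr1 ltW.
  by apply: le_trans (sqC_ip _ _ _) _; rewrite sqH_vacuum mul1r.
have b4 : sqC (- (ip u' Psi * ip Psi (v - v'))) <= (2 * sqH u + 2) * h.
  rewrite sqCN sqCM ler_pM ?sqC_ge0 //.
    by apply: le_trans (sqC_ip _ _ _) _; rewrite sqH_vacuum mulr1.
  by apply: le_trans (sqC_ip _ _ _) _; rewrite sqH_vacuum mul1r ltW.
have := sqCD (ip (piY g (u - u')) v) (ip (piY g u') (v - v')).
have := sqCD (- (ip (u - u') Psi * ip Psi v)) (- (ip u' Psi * ip Psi (v - v'))).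
move: Kh; rewrite /K; lra.
Qed.

Let orbit := [set piY g Psi | g in thompsonT R].

Lemma orbit_stable : stable_under [set (piY g : H -> H) | g in thompsonT R] (closed_span orbit).
Proof.
move=> _ [g gT <-] v /(closure_sqHP hH) Vv; apply/(closure_sqHP hH) => e /Vv.
move=> [_ [n [a [u [uA ->]]]] lt_e].
exists (piY g (\sum_(i < n) a i *: u i)); last by rewrite -linearB /= sqH_unitary.
exists n, a, (fun i => piY g (u i)); split; last first.
  by rewrite linear_sum; apply: eq_bigr => i _; rewrite linearZ.
move=> i; have [h hT <-] := uA i; exists (g \o h); first exact: thompsonT_comp.
by rewrite (rep_comp hpiY).
Qed.

Lemma orbit_vacuum : thompsonT R id /\ orbit Psi.
Proof.
have idT : thompsonT R id.
  by exists 2, caret, ord0, caret; rewrite thompson_map_id.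
by split=> //; exists id => //; rewrite (rep_id hpiY).
Qed.

Theorem irreducible_vacuum :
  acts_irreducibly [set (piY g : H -> H) | g in thompsonT R] (closed_span orbit).
Proof.
have spanV : closed_subspace (closed_span orbit) by exact: (closed_subspace_span hH).
have VPsi : closed_span orbit Psi.
  apply: subset_closure; exists 1%N, (fun=> 1), (fun=> Psi).
  by split; [move=> _; case: orbit_vacuum | rewrite big_ord1 scale1r].
split=> //.
- move=> V0; have : [set 0 : H] Psi by rewrite -V0.
  move=> Psi0; have := sqH_vacuum; rewrite Psi0 /sqH linear0r /= => /eqP.
  by rewrite eq_sym oner_eq0.
- exact: orbit_stable.
- move=> W subW WV stW.
  have stW' g v : thompsonT R g -> W v -> W (piY g v).
    by move=> gT; apply: stW; exists g.
  (* If [W] is orthogonal to the vacuum, moving group elements across the inner product makes it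
     orthogonal to the whole orbit, so it is 0. *)
  have [Wperp|] := pselect (forall w, W w -> ip w Psi = 0).
    left; apply/seteqP; split=> [w Ww /=|_ ->]; last by case: subW.
    apply: (orthogonal_closed_span hH (WV _ Ww)) => _ [g gT <-].
    have [h hT [_ hg]] := thompsonT_inv gT.
    have [Uh _] := rep_unitary hpiY hT.
    rewrite -Uh -[piY h (piY g _)](rep_comp hpiY) // hg (rep_id hpiY).
    by apply: Wperp; apply: stW'.
  (* Otherwise some [w] in [W] has translates, all in [W], that approach weakly a nonzero multiple
     of the vacuum. *)
  move=> /existsNP[w /not_implyP[Ww /eqP wPsi]]; right; apply/seteqP; split=> //.
  apply: sub_closed_span => // _ [g gT <-]; apply: (stW') => //.
  apply: (mem_of_weak_limit hH subW wPsi) => v e e0.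
  have [g' g'T lt_e] := weak_limit_vacuum w v e0.
  by exists (piY g' w); split=> //; [apply: stW' | rewrite sqH_unitary].
Qed.

End Irreducible.

(** With x = pi / n, 4 cos(x)^2 - 1 = 1 + 2 cos(2x), and 2x < pi / 2 because n >= 5. *)
Lemma parameter_gt1 (R : realType) (d : R) :
  (exists2 n : nat, (5 <= n)%N & d = 4 * cos (pi / n%:R) ^+ 2 - 1) \/ 3 <= d -> 1 < d.
Proof.
case=> [[n n5 ->]|]; last by lra.
have n0 : (0 : R) < n%:R by rewrite ltr0n; lia.
have pi0 := pi_gt0 R.
have x0 : 0 < pi / n%:R :> R by rewrite divr_gt0.
have x4 : pi / n%:R *+ 2 < pi / 2 :> R.
  rewrite -mulr_natr mulrAC ltr_pdivrMr // mulrAC ltr_pdivlMr // -mulrA ltr_pM2l //.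
  by rewrite -!natrM ltr_nat; lia.
have : 0 < cos (pi / n%:R *+ 2 : R).
  apply: cos_gt0_pihalf; rewrite x4 andbT; apply: (@lt_trans _ _ 0).
    by rewrite oppr_lt0 divr_gt0.
  by rewrite mulr2n addr_gt0.
by rewrite cos_mulr2n mulr2n; lra.
Qed.

Theorem mainTheorem3 (R : realType) (d : R)
    (hd : (exists2 n : nat, (5 <= n)%N & d = 4 * cos (pi / n%:R) ^+ 2 - 1)
          \/ 3 <= d)
    (H : completeNormedModType R[i]) (ip : {dot H for (@Num.conj R[i])})
    (hH : hilbert_norm ip)
    (iota : forall n, tree n -> {linear Cspace d n -> H})
    (hiota : direct_limit_completion ip iota)
    (piY : (R -> R) -> {linear H -> H})
    (hpiY : thompson_representation ip iota piY) :
  acts_irreducibly [set (piY g : H -> H) | g in thompsonT R]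
    (closed_span [set piY g (vacuum iota) | g in thompsonT R]).
Proof. exact: (irreducible_vacuum (parameter_gt1 hd) hH hiota hpiY). Qed.
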